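(* Let $0\le\lambda<\sqrt6$ and consider the system $$S'=-\tfrac{1}{3\sqrt3}-\tfrac23S+\tfrac1{\sqrt3}S^2+\tfrac1{\sqrt3}U^2+\tfrac1{2\sqrt3}P^2+2S^3-SU^2+SP^2,$$ $$U'=U\bigl(\tfrac13-\tfrac\lambda2P+2S^2-U^2+P^2\bigr),\qquad P'=-\tfrac23P+\lambda U^2+2S^2P-U^2P+P^3 .$$ At its critical point $P_2=(S,U,P)=\Bigl(0,\sqrt{\tfrac{6-\lambda^2}{18}},\tfrac\lambda3\Bigr)$ the linearization has eigenvalues $-1+\frac{\lambda^2}6$ (twice) and $-\frac23+\frac{\lambda^2}3$. For $\tau\to\infty$, $P_2$ is asymptotically stable if $\lambda<\sqrt2$ and unstable if $\sqrt2\le\lambda<\sqrt6$.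
   Context: The prime denotes $d/d\tau$; stability and asymptotic stability are in the sense of Lyapunov, in $\mathbb{R}^3$ with coordinates $(S,U,P)$. *)

(* Defs.v *)
From HB Require Import structures.
From mathcomp Require Import all_boot all_order all_algebra.
From mathcomp Require Import all_classical all_reals all_analysis.
Set Implicit Arguments.
Unset Strict Implicit.
Unset Printing Implicit Defensive.
Import Order.TTheory GRing.Theory Num.Theory.
Import numFieldNormedType.Exports.
Local Open Scope classical_set_scope.
Local Open Scope ring_scope.

Definition row3 (R : realType) (a b c : R) : 'rV[R]_3 :=
  \row_(j < 3) [:: a; b; c]`_j.

(* [x] solves x' = F x on [0, T[, where T may be +oo.  At the left endpoint
   only continuity is required; for continuous F it then follows that x has
   right derivative F (x 0) at 0. *)
Definition solves_on (R : realType) (n : nat)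
    (F : 'rV[R]_n.+1 -> 'rV[R]_n.+1) (T : \bar R) (x : R -> 'rV[R]_n.+1) : Prop :=
  {within [set t : R | 0 <= t /\ (t%:E < T)%E], continuous x} /\
  forall t : R, 0 < t -> (t%:E < T)%E -> is_derive t 1 x (F (x t)).

(* All solutions are considered, on arbitrary forward time intervals, so the
   negation provides an actual solution that leaves a fixed ball.  The norm of 'rV[R]_n.+1 is the sup norm; the notions below are unchanged under
   an equivalent norm. *)
Definition lyapunov_stable (R : realType) (n : nat)
    (F : 'rV[R]_n.+1 -> 'rV[R]_n.+1) (p : 'rV[R]_n.+1) : Prop :=
  forall eps : R, 0 < eps -> exists2 delta : R, 0 < delta &
    forall (T : \bar R) (x : R -> 'rV[R]_n.+1),
      solves_on F T x -> `|x 0 - p| < delta ->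
      forall t : R, 0 <= t -> (t%:E < T)%E -> `|x t - p| < eps.

(* Solutions starting near [p] are required to exist for all forward time, so
   that the convergence claim is not vacuous. *)
Definition attractive (R : realType) (n : nat)
    (F : 'rV[R]_n.+1 -> 'rV[R]_n.+1) (p : 'rV[R]_n.+1) : Prop :=
  exists2 delta : R, 0 < delta &
    forall x0 : 'rV[R]_n.+1, `|x0 - p| < delta ->
      (exists x : R -> 'rV[R]_n.+1, solves_on F +oo%E x /\ x 0 = x0) /\
      (forall x : R -> 'rV[R]_n.+1, solves_on F +oo%E x -> x 0 = x0 ->
         x t @[t --> +oo] --> p).

Definition asymptotically_stable (R : realType) (n : nat)
    (F : 'rV[R]_n.+1 -> 'rV[R]_n.+1) (p : 'rV[R]_n.+1) : Prop :=
  lyapunov_stable F p /\ attractive F p.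

Definition unstable (R : realType) (n : nat)
    (F : 'rV[R]_n.+1 -> 'rV[R]_n.+1) (p : 'rV[R]_n.+1) : Prop :=
  ~ lyapunov_stable F p.

(* [s] lists the eigenvalues of [A], repeated by algebraic multiplicity. *)
Definition eigenvalues_of (R : realType) (n : nat) (A : 'M[R]_n) (s : seq R)
    : Prop :=
  char_poly A = \prod_(a <- s) ('X - a%:P).

Definition vfield (R : realType) (lambda : R) (x : 'rV[R]_3) : 'rV[R]_3 :=
  let r3 : R := Num.sqrt 3 in
  let S : R := x 0 0 in
  let U : R := x 0 1 in
  let P : R := x 0 2 in
  row3
    (- (1 / (3 * r3)) - 2 / 3 * S + 1 / r3 * S ^+ 2 + 1 / r3 * U ^+ 2
       + 1 / (2 * r3) * P ^+ 2 + 2 * S ^+ 3 - S * U ^+ 2 + S * P ^+ 2)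
    (U * (1 / 3 - lambda / 2 * P + 2 * S ^+ 2 - U ^+ 2 + P ^+ 2))
    (- (2 / 3) * P + lambda * U ^+ 2 + 2 * S ^+ 2 * P - U ^+ 2 * P + P ^+ 3).

Definition P2 (R : realType) (lambda : R) : 'rV[R]_3 :=
  row3 0 (Num.sqrt ((6 - lambda ^+ 2) / 18)) (lambda / 3).

(* Main.v *)
(* Write [U], [l / 3] for the nonzero coordinates of [P2]. Because
   [18 U^2 = 6 - l^2], the linearization at [P2] is diagonalizable with
   eigenvalues [- 3 U^2] (twice) and [mu = - 2 U^2 + 2 l^2 / 9], so after a
   linear change of coordinates the field is [y |-> diag(d) y + O(|y|^2)].

   If [l < sqrt 2], all [d_i] are negative and [sum_i y_i^2] decays
   exponentially along every trajectory starting close to [0]; such a trajectory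
   exists for all time, since it also solves the field cut off outside a ball,
   which is bounded and Lipschitz (Picard iteration).

   If [l >= sqrt 2], let [h] be the coordinate of [mu] and [w] the other two. On
   the axis [w = 0] the [h]-component of the field is at least [c h^2] for small
   [h > 0]: if [mu > 0] by the linear term, if [mu = 0] because the quadratic
   coefficient is [6]. In a thin cone [|w| < k h] one still has
   [h' >= (c / 2) h^2], and [|w|^2 - k^2 h^2] is contracted because of the
   negative eigenvalues. So solutions starting on the axis stay in the cone, and
   [h] grows at least linearly until they leave a fixed ball. *)

Require Import Defs.
From HB Require Import structures.
From mathcomp Require Import all_boot all_order all_algebra.
From mathcomp Require Import all_classical all_reals all_analysis.
From mathcomp Require Import ring lra.
Set Implicit Arguments.
Unset Strict Implicit.
Unset Printing Implicit Defensive.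
Import Order.TTheory GRing.Theory Num.Theory.
Import numFieldNormedType.Exports.
Local Open Scope classical_set_scope.
Local Open Scope ring_scope.

(** * Global solutions of bounded Lipschitz fields *)

Section RowNorm.
Context {R : realType} {n : nat}.
Implicit Types x y : 'rV[R]_n.

Lemma ler_entry_norm m (A : 'M[R]_(m, n)) i j : `|A i j| <= `|A|.
Proof.
by rewrite [leRHS]/Num.norm/= mx_normrE; exact: (le_bigmax _ _ (i, j)).
Qed.

Lemma ler_coord_norm x i : `|x 0 i| <= `|x|.
Proof. exact: ler_entry_norm. Qed.

Lemma rV_norm_le x c : 0 <= c -> (forall i, `|x 0 i| <= c) -> `|x| <= c.
Proof.
move=> c0 xc; rewrite [leLHS]/Num.norm/= mx_normrE.
by apply: bigmax_le => // -[i j] _ /=; rewrite ord1.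
Qed.

Lemma rV_derive (x : R -> 'rV[R]_n) (t : R) (v : 'rV[R]_n) :
  is_derive t 1 x v <-> forall i, is_derive t 1 (fun s => x s 0 i) (v 0 i).
Proof.
split=> [[dx xv] i|dx].
  split; first exact: (derivable_mxP _ _ _).1 dx 0 i.
  by rewrite -xv derive_mx// mxE.
have dxt : derivable x t 1.
  apply/derivable_mxP => i j; rewrite ord1; have /= := dx j.
  by case.
split=> //; rewrite derive_mx//; apply/rowP => i; rewrite mxE.
by have [] := dx i.
Qed.

End RowNorm.

(** * Mean value bounds and primitives on the real line *)

Section RealDerive.
Context {R : realType}.
Implicit Types (f F H : R -> R).

Lemma is_derive_scale (k t : R) : is_derive t 1 ( *%R k) k.
Proof. by apply: is_derive_eq; rewrite /GRing.scale/= mulr1. Qed.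

Lemma is_derive_expR_scale (C k t : R) :
  is_derive t 1 (fun s => C * expR (k * s)) (C * (k * expR (k * t))).
Proof.
have ? := is_derive_scale k t.
have d : is_derive t 1 (expR \o *%R k) (expR (k * t) * k).
  exact: is_derive1_comp.
have := @is_deriveZ _ _ _ (expR \o *%R k) C t 1 _ d.
by rewrite /GRing.scale/= [expR _ * k]mulrC.
Qed.

(** The mean value theorem for [H - F] and [H + F], whose derivatives are nonnegative, gives the two
    halves of the bound. This stands in for norm estimates of integrals. *)
Lemma derive_bound F H f (h : R -> R) (a b : R) : a <= b ->
  (forall t, a <= t -> is_derive t 1 F (f t)) ->
  (forall t, a <= t -> is_derive t 1 H (h t)) ->
  (forall t, a <= t -> `|f t| <= h t) ->
  `|F b - F a| <= H b - H a.
Proof.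
move=> ab dF dH fh.
have cont (g dg : R -> R) : (forall t, a <= t -> is_derive t 1 g (dg t)) ->
    {within `[a, b], continuous g}.
  move=> g'; apply: derivable_within_continuous => x.
  by rewrite in_itv/= => /andP[ax _]; have [] := g' x ax.
have d1 t : a <= t -> is_derive t 1 (H \- F) (h t - f t).
  by move=> at_; have ? := dF t at_; have ? := dH t at_; exact: is_deriveB.
have d2 t : a <= t -> is_derive t 1 (H \+ F) (h t + f t).
  by move=> at_; have ? := dF t at_; have ? := dH t at_; exact: is_deriveD.
have sub x : x \in `]a, b[ -> a <= x by rewrite in_itv/= => /andP[/ltW].
have [c /andP[+ _] /=] := @MVT_segment R (H \- F) (h \- f) _ _ ab
  (fun x xab => d1 x (sub x xab)) (cont _ _ d1).
rewrite bnd_simp => ac e1.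
have [e /andP[+ _] /=] := @MVT_segment R (H \+ F) (h \+ f) _ _ ab
  (fun x xab => d2 x (sub x xab)) (cont _ _ d2).
rewrite bnd_simp => ae e2.
have := fh c ac; have := fh e ae; rewrite !ler_norml => /andP[? ?] /andP[? ?].
have ? : 0 <= (h c - f c) * (b - a) by rewrite mulr_ge0//; lra.
have ? : 0 <= (h e + f e) * (b - a) by rewrite mulr_ge0//; lra.
by apply/andP; split; lra.
Qed.

(** Integrating from [-1] makes [0] an interior point, so that the derivative at [0] is two-sided;
    the second integral normalizes the value at [0]. *)
Definition primitive f (t : R) : R :=
  \int[lebesgue_measure]_(s in `[-1, t]) f s
  - \int[lebesgue_measure]_(s in `[-1, 0]) f s.

Lemma primitive0 f : primitive f 0 = 0.
Proof. exact: subrr. Qed.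

Lemma is_derive_primitive f (t : R) : continuous f -> 0 <= t ->
  is_derive t 1 (primitive f) (f t).
Proof.
move=> cf t0.
have fi : lebesgue_measure.-integrable `[-1, t + 1] (EFin \o f).
  apply: continuous_compact_integrable; first exact: segment_compact.
  exact: continuous_subspaceT.
have tt : t < t + 1 by rewrite ltrDl.
have t1 : -1 < t by rewrite (lt_le_trans _ t0)// ltrN10.
have [dF F'] := continuous_FTC1_closed tt fi t1 (cf t).
rewrite -[f t]subr0 /primitive.
apply: is_deriveB.
by split=> //; rewrite -derive1E.
Qed.

End RealDerive.

(** * Geometrically convergent sequences *)

Section GeometricCauchy.
Context {R : realType}.

Lemma le0_of_le_geometric (x B : R) : (forall k, x <= B / 2 ^+ k) -> x <= 0.
Proof.
move=> xB; have : geometric B (2^-1) @ \oo --> (0 : R).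
  by apply: cvg_geometric; rewrite ger0_norm ?invf_lt1 ?ltr1n.
move=> /cvgr_to_ge; apply; near=> k.
by rewrite /geometric/= exprVn; exact: xB.
Unshelve. all: by end_near. Qed.

Lemma cvg_geometric_bound (V : completeNormedModType R) (u : nat -> V) (B : R) :
  (forall k, `|u k.+1 - u k| <= B / 2 ^+ k) ->
  exists l, forall k, `|l - u k| <= 2 * B / 2 ^+ k.
Proof.
move=> uB.
(* The difference of two tails of the geometric series, unlike the bare bound [2 * B / 2 ^+ k], is
   strong enough for induction on [m]. *)
have um k m : `|u (k + m)%N - u k| <= 2 * B / 2 ^+ k - 2 * B / 2 ^+ (k + m).
  elim: m => [|m IH]; first by rewrite addn0 !subrr normr0.
  rewrite addnS -(subrKA (u (k + m)%N)).
  apply: (le_trans (ler_normD _ _)); apply: (le_trans (lerD (uB _) IH)).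
  rewrite (_ : 2 * B / 2 ^+ (k + m).+1 = B / 2 ^+ (k + m)); last first.
    by rewrite exprS; field; rewrite expf_neq0.
  lra.
have B0 : 0 <= B by have := uB 0; rewrite expr0 divr1; apply: le_trans.
have uk k m : (k <= m)%N -> `|u m - u k| <= 2 * B / 2 ^+ k.
  move=> /subnKC <-; apply: (le_trans (um _ _)).
  by rewrite lerBlDr lerDl divr_ge0 ?mulr_ge0 ?exprn_ge0.
have : cvg (u @ \oo).
  apply/cauchy_cvgP/cauchy_exP => e e0.
  have [k ke] : exists k, 2 * B / 2 ^+ k < e.
    apply/not_existsP => H; have := @le0_of_le_geometric e (2 * B).
    rewrite leNgt e0/=; suff: forall k, e <= 2 * B / 2 ^+ k by move=> /[swap]/[apply].
    by move=> k; rewrite leNgt; exact/negP/H.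
  exists (u k); exists k => // m /= km.
  by rewrite -ball_normE/= distrC (le_lt_trans (uk _ _ km)).
move=> ul; exists (lim (u @ \oo)) => k.
have : `|u m - u k| @[m --> \oo] --> `|lim (u @ \oo) - u k|.
  by apply: cvg_norm; apply: cvgB => //; exact: cvg_cst.
move=> /cvgr_to_le; apply; near=> m.
by apply: uk; near: m; exists k.
Unshelve. all: by end_near. Qed.

(** The scalar case in each coordinate; the sup norm preserves the constant. *)
Lemma rV_cvg_geometric_bound n (u : nat -> 'rV[R]_n) (B : R) :
  (forall k, `|u k.+1 - u k| <= B / 2 ^+ k) ->
  exists l, forall k, `|l - u k| <= 2 * B / 2 ^+ k.
Proof.
move=> uB.
have B0 : 0 <= B by have := uB 0; rewrite expr0 divr1; apply: le_trans.
have lims i : exists l, forall k, `|l - u k 0 i| <= 2 * B / 2 ^+ k.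
  apply: (@cvg_geometric_bound R^o) => k; apply: le_trans (uB k).
  by have := ler_coord_norm (u k.+1 - u k) i; rewrite !mxE.
have [l lB] := choice lims.
exists (\row_i l i) => k; apply: rV_norm_le => [|i].
  by rewrite divr_ge0 ?mulr_ge0 ?exprn_ge0.
by rewrite !mxE.
Qed.

End GeometricCauchy.

Lemma lipschitz_continuous {R : realType} (f : R -> R) (K : R) : 0 <= K ->
  (forall s t, `|f s - f t| <= K * `|s - t|) -> continuous f.
Proof.
move=> K0 fK s; apply/cvgrPdist_lt => e e0.
have K1 : 0 < K + 1 by rewrite ltr_wpDl.
apply/nbhs_ballP; exists (e / (K + 1)); first exact: divr_gt0.
move=> r sr; have {}sr : `|s - r| < e / (K + 1) by [].
rewrite ltr_pdivlMr// in sr.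
apply: le_lt_trans (fK _ _) (le_lt_trans _ sr).
by rewrite mulrDr mulr1 mulrC lerDl.
Qed.

(** * Picard iteration in an exponentially weighted norm *)

Section Picard.
Context {R : realType} {n : nat}.
Variables (G : 'rV[R]_n.+1 -> 'rV[R]_n.+1) (L M : R) (x0 : 'rV[R]_n.+1).
Hypothesis L0 : 0 <= L.
Hypothesis GM : forall x, `|G x| <= M.
Hypothesis GL : forall x y, `|G x - G y| <= L * `|x - y|.
Implicit Types u v : R -> 'rV[R]_n.+1.

Let M0 : 0 <= M.
Proof. exact: le_trans (normr_ge0 _) (GM 0). Qed.

(** All iterates share the Lipschitz constant [M], the bound on [G]. This makes the integrands
    continuous, and it passes to the limit. *)
Let lip u := forall s t : R, 0 <= s -> 0 <= t -> `|u s - u t| <= M * `|s - t|.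

(* The truncation at [0] makes the integrand continuous on the whole line when
   [u] is only controlled on the half line. *)
Let op u (t : R) : 'rV[R]_n.+1 :=
  x0 + \row_i primitive (fun s => G (u (Num.max s 0)) 0 i) t.

Let max0_lip (s t : R) : `|Num.max s 0 - Num.max t 0| <= `|s - t|.
Proof.
have h1 := ler_norm (s - t); have := ler_norm (t - s); rewrite distrC => h2.
rewrite ler_norml /Num.max.
by case: (ltP s 0) => ?; case: (ltP t 0) => ?; apply/andP; split; lra.
Qed.

Let op_derive u : lip u -> forall t : R, 0 <= t -> is_derive t 1 (op u) (G (u t)).
Proof.
move=> ul t t0; rewrite -[G _]add0r; apply: is_deriveD.
apply/rV_derive => i; rewrite /=.
under [X in is_derive _ _ X _]eq_fun do rewrite mxE.
rewrite -[in u t](max_l t0).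
apply: (@is_derive_primitive _ (fun s => G (u (Num.max s 0)) 0 i)) => // s.
apply: (@lipschitz_continuous _ _ (L * M)); first exact: mulr_ge0.
move=> {}s r; have : `|(G (u (Num.max s 0)) - G (u (Num.max r 0))) 0 i| <= L * (M * `|s - r|).
  apply: (le_trans (ler_coord_norm _ _)); apply: (le_trans (GL _ _)).
  rewrite ler_wpM2l//; apply: (le_trans (ul _ _ _ _)); rewrite ?le_max ?lexx ?orbT//.
  by rewrite ler_wpM2l.
by rewrite !mxE mulrA.
Qed.

Let op0 u : op u 0 = x0.
Proof. by apply/rowP => i; rewrite !mxE primitive0 addr0. Qed.

Let op_lip u : lip u -> lip (op u).
Proof.
move=> ul.
suff H (s t : R) : 0 <= t -> t <= s -> `|op u s - op u t| <= M * `|s - t|.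
  move=> s t s0 t0; case/orP: (le_total s t) => st; last exact: H.
  by rewrite distrC (distrC s) H.
move=> t0 ts; apply: rV_norm_le => [|i]; first by rewrite mulr_ge0.
rewrite mxE [X in _ + X]mxE (ger0_norm (_ : 0 <= s - t)) ?subr_ge0// mulrBr.
have := @derive_bound _ (fun r => op u r 0 i) (fun r => M * r)
  (fun r => G (u r) 0 i) (fun=> M) t s ts; apply.
- by move=> r tr; apply: (rV_derive _ _ _).1; apply: op_derive => //; exact: le_trans tr.
- by move=> r _; exact: is_derive_scale.
- by move=> r _; apply: le_trans (ler_coord_norm _ _) (GM _).
Qed.

(** Exponent of the weighted norm [sup |u t| * expR (- K * t)]: [K >= 2 * L] makes [op] contract by
    [1 / 2], and [K >= 1] lets [M * expR (K * t)] dominate the first increment [M * t]. *)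
Let K := 2 * L + 1.

Let op_contr u v (C : R) : lip u -> lip v ->
  (forall t : R, 0 <= t -> `|u t - v t| <= C * expR (K * t)) ->
  forall t : R, 0 <= t -> `|op u t - op v t| <= C / 2 * expR (K * t).
Proof.
move=> ul vl uv t t0.
have C0 : 0 <= C.
  have := uv 0 (lexx _); rewrite mulr0 expR0 mulr1; exact: le_trans.
apply: rV_norm_le => [|i]; first by rewrite mulr_ge0 ?divr_ge0 ?expR_ge0.
have du (r : R) : 0 <= r -> is_derive r 1 (fun s => op u s 0 i) (G (u r) 0 i).
  by move=> r0; apply: (rV_derive _ _ _).1; exact: op_derive.
have dv (r : R) : 0 <= r -> is_derive r 1 (fun s => op v s 0 i) (G (v r) 0 i).
  by move=> r0; apply: (rV_derive _ _ _).1; exact: op_derive.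
have := @derive_bound _ (fun r => op u r 0 i - op v r 0 i)
  (fun r => C / 2 * expR (K * r))
  (fun r => G (u r) 0 i - G (v r) 0 i)
  (fun r => C / 2 * (K * expR (K * r))) 0 t t0.
rewrite !op0 subrr subr0 mulr0 expR0 mulr1 => H.
have /le_trans : `|op u t 0 i - op v t 0 i| <= C / 2 * expR (K * t) - C / 2.
  apply: H => r r0.
  - by have ? := du r r0; have ? := dv r r0; exact: is_deriveB.
  - exact: is_derive_expR_scale.
  - have := ler_coord_norm (G (u r) - G (v r)) i; rewrite !mxE => /le_trans; apply.
    apply: (le_trans (GL _ _)); apply: (le_trans (ler_wpM2l L0 (uv r r0))).
    have : 0 <= C * expR (K * r) by rewrite mulr_ge0 ?expR_ge0.
    by rewrite /K; lra.
rewrite !mxE; apply.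
by rewrite lerBlDr lerDl divr_ge0.
Qed.

Let it k : R -> 'rV[R]_n.+1 := iter k op (fun=> x0).

Let it_lip k : lip (it k).
Proof.
elim: k => [s t _ _|k IH]; last exact: op_lip.
by rewrite subrr normr0 mulr_ge0.
Qed.

Let it_step k (t : R) : 0 <= t -> `|it k.+1 t - it k t| <= M * expR (K * t) / 2 ^+ k.
Proof.
rewrite mulrAC; elim: k t => [|k IH] t t0; last first.
  rewrite exprSr invfM [M * _]mulrA; exact: op_contr (it_lip k.+1) (it_lip k) IH t t0.
rewrite expr0 divr1 -[it 0 t](op0 (it 0)).
apply: (le_trans (op_lip (it_lip 0) t0 (lexx _))).
rewrite subr0 ger0_norm// ler_wpM2l//; apply: le_trans (expR_ge1Dx _).
have : 0 <= L * t by rewrite mulr_ge0.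
by rewrite /K; lra.
Qed.

Lemma global_solution :
  exists x : R -> 'rV[R]_n.+1, solves_on G +oo%E x /\ x 0 = x0.
Proof.
(* The condition [0 <= t] sits inside the existential so that [choice] yields a function on the
   whole line. *)
have lims (t : R) : exists l : 'rV[R]_n.+1, 0 <= t -> forall k,
    `|l - it k t| <= 2 * (M * expR (K * t)) / 2 ^+ k.
  have [t0|] := leP 0 t; last by exists x0.
  have [l lB] := rV_cvg_geometric_bound (fun k => it_step k t0).
  by exists l.
have [u ul] := choice lims.
have ulip : lip u.
  move=> s t s0 t0; rewrite -subr_le0.
  apply: (@le0_of_le_geometric _ _
    (2 * (M * expR (K * s)) + 2 * (M * expR (K * t)))) => k.
  have us := ul s s0 k; have ut := ul t t0 k; rewrite distrC in ut.
  have ust := it_lip k s0 t0.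
  have := ler_distD (it k s) (u s) (u t).
  have := ler_distD (it k t) (it k s) (u t).
  by rewrite mulrDl; lra.
(* Both [op u] and [u] are within a geometrically small error of [it k.+1 = op (it k)], so [u] is a
   fixed point on the half line. *)
have opu (t : R) : 0 <= t -> op u t = u t.
  move=> t0; apply/eqP; rewrite -subr_eq0 -normr_le0.
  apply: (@le0_of_le_geometric _ _ (2 * (M * expR (K * t)))) => k.
  have uB := ul t t0.
  rewrite -(subrKA (it k.+1 t)); apply: (le_trans (ler_normD _ _)).
  have := uB k.+1; rewrite -normrN opprB => uB1.
  have C1 (s : R) : 0 <= s -> `|u s - it k s| <= 2 * M / 2 ^+ k * expR (K * s).
    move=> s0; have /le_trans := ul s s0 k; apply.
    by rewrite le_eqVlt; apply/orP; left; apply/eqP; ring.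
  apply: (le_trans (lerD (op_contr ulip (it_lip k) C1 t0) uB1)).
  rewrite exprS le_eqVlt; apply/orP; left; apply/eqP.
  by field; rewrite expf_neq0.
have dop (t : R) : 0 <= t -> is_derive t 1 (op u) (G (op u t)).
  by move=> t0; rewrite (opu t t0); exact: op_derive.
(* The witness is [op u] and not [u]: the values of [u] at negative times are arbitrary, whereas
   [op u] has a two-sided derivative at [0], hence is continuous there. *)
exists (op u); split; last exact: op0.
split=> [|t t0 _]; last exact/dop/ltW.
apply: continuous_in_subspaceT => t /set_mem/= [t0 _].
by apply/differentiable_continuous/derivable1_diffP; case: (dop t t0).
Qed.

End Picard.

(** * Local solutions by cut-off *)

Section LocalSolution.
Context {R : realType} {n : nat}.

Let clamp (r : R) (x : 'rV[R]_n.+1) : 'rV[R]_n.+1 :=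
  \row_i Num.max (- r) (Num.min r (x 0 i)).

Let clamp_norm (r : R) x : 0 <= r -> `|clamp r x| <= r.
Proof.
move=> r0; apply: rV_norm_le => // i; rewrite mxE ler_norml /Num.max /Num.min.
case: (ltP r (x 0 i)) => ?; case: ltP => ?; apply/andP; split; lra.
Qed.

Let clamp_id (r : R) x : `|x| <= r -> clamp r x = x.
Proof.
move=> xr; apply/rowP => i; rewrite mxE.
have := le_trans (ler_coord_norm x i) xr; rewrite ler_norml => /andP[? ?].
by rewrite min_r// max_r.
Qed.

Let clamp_lip (r : R) x y : `|clamp r x - clamp r y| <= `|x - y|.
Proof.
apply: rV_norm_le => // i; rewrite !mxE.
have := ler_coord_norm (x - y) i; rewrite !mxE !ler_norml => /andP[? ?].
have := normr_ge0 (x - y) => ?.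
rewrite /Num.max /Num.min.
case: (ltP r (x 0 i)) => ?; case: (ltP r (y 0 i)) => ?;
  case: ltP => ?; case: ltP => ?; apply/andP; split; lra.
Qed.

(* The solution is that of the field composed with a coordinatewise cut-off. *)
Lemma local_solution (G : 'rV[R]_n.+1 -> 'rV[R]_n.+1) (L r : R) :
  0 <= L -> 0 <= r ->
  (forall x y, `|x| <= r -> `|y| <= r -> `|G x - G y| <= L * `|x - y|) ->
  forall x0, exists x : R -> 'rV[R]_n.+1,
    [/\ x 0 = x0, {within [set t : R | 0 <= t], continuous x} &
        forall t : R, 0 < t -> `|x t| <= r -> is_derive t 1 x (G (x t))].
Proof.
move=> L0 r0 GL x0.
have [||x [[xc dx] xx0]] := @global_solution _ _ (G \o clamp r) L
    (`|G 0| + L * r) x0 L0.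
- move=> x /=; rewrite -[G (clamp r x)](subrK (G 0)).
  apply: (le_trans (ler_normD _ _)); rewrite addrC lerD2l.
  apply: le_trans (GL _ _ (clamp_norm _ r0) _) _; first by rewrite normr0.
  by rewrite subr0 ler_wpM2l// clamp_norm.
- move=> x y /=; apply: le_trans (GL _ _ (clamp_norm _ r0) (clamp_norm _ r0)) _.
  by rewrite ler_wpM2l.
exists x; split=> //.
- by apply: continuous_subspaceW xc => t /= t0; rewrite ltry.
- by move=> t t0 xr; have := dx t t0 (ltry _); rewrite /= clamp_id.
Qed.

End LocalSolution.

(** * First exit times and a differential inequality *)

Section Comparison.
Context {R : realType}.

(** [T] is the infimum of the times in [[0, b]] with [m <= f t]: continuity shows that it is
    attained, and [f 0 < m] excludes [0]. *)
Lemma first_exit (f : R -> R) (b m : R) : 0 <= b ->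
  {within `[0, b], continuous f} -> f 0 < m -> m <= f b ->
  exists T : R, [/\ 0 < T, T <= b, m <= f T & forall s : R, 0 <= s -> s < T -> f s < m].
Proof.
move=> b0 fc f0 fb.
pose A := [set t : R | [/\ 0 <= t, t <= b & m <= f t]].
have Ai : has_inf A by split; [exists b | exists 0 => t []].
have AT (t : R) : A t -> inf A <= t by apply: ge_inf; exact: Ai.2.
have T0 : 0 <= inf A by apply: lb_le_inf Ai.1 _ => t [].
have Tb : inf A <= b by exact: AT.
have fT : m <= f (inf A).
  rewrite leNgt; apply/negP => fTm.
  have Tab : `[0, b]%classic (inf A) by rewrite /= in_itv/= T0.
  have /cvgrPdist_lt /(_ (m - f (inf A))) := (subspace_continuousP _ _).1 fc _ Tab.
  rewrite subr_gt0 => /(_ fTm) /nbhs_ballP[d /= d0 fd].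
  have [t [t0 tb mt] tT] := inf_adherent d0 Ai.
  have bt : `|inf A - t| < d.
    have At : inf A <= t by apply: AT.
    by rewrite ltr_norml; apply/andP; split; lra.
  have : `|f (inf A) - f t| < m - f (inf A).
    by apply: fd bt _; rewrite /= in_itv/= t0.
  by rewrite ltr_norml => /andP[? _]; lra.
exists (inf A); split=> //.
- by rewrite lt_neqAle T0 andbT; apply/eqP => T0'; rewrite -T0' in fT; lra.
- move=> s s0 sT; rewrite ltNge; apply/negP => ms.
  have /AT : A s by split=> //; lra.
  by lra.
Qed.

(** The derivative of [f t * expR (c * t)] is at most [0], so the mean value theorem compares the
    endpoints. The sign of [c] is free; [c = 0] gives monotonicity. *)
Lemma gronwall (f df : R -> R) (c b : R) : 0 <= b ->
  {within `[0, b], continuous f} ->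
  (forall t : R, 0 < t -> t < b -> is_derive t 1 f (df t) /\ df t <= - c * f t) ->
  f b <= f 0 * expR (- c * b).
Proof.
rewrite le_eqVlt => /predU1P[<-|b0] fc fd.
  by rewrite mulr0 expR0 mulr1.
pose e : R -> R := expR \o *%R c.
have de (t : R) : is_derive t 1 e (e t * c).
  by have ? := is_derive_scale c t; exact: is_derive1_comp.
have ec : continuous e.
  by move=> t; apply/differentiable_continuous/derivable1_diffP; case: (de t).
have [||d /andP[d0 db] ] := @MVT _ (f * e)
  (fun t => f t *: (e t * c) + e t *: df t) 0 b b0.
- move=> t; rewrite in_itv/= => /andP[t0 tb].
  by have [? _] := fd t t0 tb; have ? := de t; exact: is_deriveM.
- move=> t; apply: continuousM; first exact: fc.
  exact: continuous_subspaceT.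
rewrite -[(f * e) b]/(f b * expR (c * b)) -[(f * e) 0]/(f 0 * expR (c * 0)).
rewrite -[e d]/(expR (c * d)) /GRing.scale/=.
rewrite !bnd_simp in d0 db; rewrite mulr0 expR0 mulr1 subr0 => E.
have [_ dd] := fd d d0 db.
have e0 := expR_gt0 (c * d).
have : (f d * (expR (c * d) * c) + expR (c * d) * df d) * b <= 0.
  rewrite pmulr_lle0//.
  have -> : f d * (expR (c * d) * c) + expR (c * d) * df d =
    expR (c * d) * (c * f d + df d) by ring.
  by rewrite pmulr_rle0//; lra.
rewrite -E subr_le0 mulNr expRN ler_pdivlMr ?expR_gt0//.
Qed.

End Comparison.

(** * Diagonal quadratic forms along trajectories *)

Section QuadraticForm.
Context {R : realType} {n : nat}.
Implicit Types (w : 'I_n.+1 -> R) (x : 'rV[R]_n.+1).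

(** Unit weights give the Lyapunov function of a sink; one negative weight gives the form whose
    negative set is the cone of the unstable case. *)
Definition quad w x : R := \sum_i w i * x 0 i ^+ 2.

Lemma continuous_quad w : continuous (quad w).
Proof.
apply: continuous_big => [|i _]; first exact: add_continuous.
move=> x; have c : {for x, continuous (fun y : 'rV[R]_n.+1 => y 0 i)}.
  exact: coord_continuous.
have cw : {for x, continuous (fun _ : 'rV[R]_n.+1 => w i)} by exact: cst_continuous.
exact: continuousM cw (continuousM c c).
Qed.

Lemma is_derive_quad w (x : R -> 'rV[R]_n.+1) (t : R) v :
  is_derive t 1 x v ->
  is_derive t 1 (quad w \o x) (\sum_i w i * (2 * x t 0 i * v 0 i)).
Proof.
move=> /rV_derive dx.
have d i : is_derive t 1 (w i \*: ((fun s => x s 0 i) ^+ 2))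
    (w i * (2 * x t 0 i * v 0 i)).
  have := is_deriveZ (w i) (is_deriveX 2 (dx i)).
  by rewrite /GRing.scale/= expr1.
rewrite (_ : quad w \o x = \sum_i (w i \*: ((fun s => x s 0 i) ^+ 2))).
  apply: is_derive_sum.
by apply/funext => s; rewrite /quad/= fct_sumE.
Qed.

Lemma within_continuous_quad w (A : set R) (x : R -> 'rV[R]_n.+1) :
  {within A, continuous x} -> {within A, continuous (quad w \o x)}.
Proof. move=> xc t; apply: (@continuous_comp (subspace A) _ _ x (quad w)).
  exact: xc.
exact: continuous_quad.
Qed.

End QuadraticForm.

(** * Stability of fields with diagonal linear part *)

Section SecondOrder.
Context {R : realType} {p q : nat}.

(* Holds near [0] for the remainder of the first-order Taylor expansion of any
   C^2 field. *)
Definition second_order (r : R) (N : 'rV[R]_p -> 'rV[R]_q) (C : R) : Prop :=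
  N 0 = 0 /\ forall (rho : R) x y, rho <= r -> `|x| <= rho -> `|y| <= rho ->
    `|N x - N y| <= C * rho * `|x - y|.

Lemma second_order_norm r (N : 'rV[R]_p -> 'rV[R]_q) C x :
  second_order r N C -> `|x| <= r -> `|N x| <= C * `|x| ^+ 2.
Proof.
move=> [N0 NC] x1; have := NC `|x| x 0 x1 (lexx _).
by rewrite normr0 N0 !subr0 expr2 mulrA => ->.
Qed.

End SecondOrder.

Section DiagonalField.
Context {R : realType} {n : nat}.
Implicit Types (N : 'rV[R]_n.+1 -> 'rV[R]_n.+1) (d x y : 'rV[R]_n.+1).

Definition diag_field d N x : 'rV[R]_n.+1 := x *m diag_mx d + N x.

Lemma diag_fieldE d N x i : diag_field d N x 0 i = x 0 i * d 0 i + N x 0 i.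
Proof. by rewrite mxE mul_mx_diag mxE. Qed.

Lemma diag_field_lipschitz d N C x y : 0 <= C -> second_order 1 N C ->
  `|x| <= 1 -> `|y| <= 1 ->
  `|diag_field d N x - diag_field d N y| <= (`|d| + C) * `|x - y|.
Proof.
move=> C0 [_ NC] x1 y1; rewrite /diag_field opprD addrACA -mulmxBl.
apply: (le_trans (ler_normD _ _)); rewrite mulrDl lerD//.
  apply: rV_norm_le => [|i]; first exact: mulr_ge0.
  by rewrite mul_mx_diag mxE normrM mulrC ler_pM// ler_coord_norm.
by have := NC 1 x y (lexx _) x1 y1; rewrite mulr1.
Qed.

Lemma diag_field_solution d N C : 0 <= C -> second_order 1 N C ->
  forall x0, exists x : R -> 'rV[R]_n.+1,
    [/\ x 0 = x0, {within [set t : R | 0 <= t], continuous x} &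
        forall t : R, 0 < t -> `|x t| <= 1 ->
          is_derive t 1 x (diag_field d N (x t))].
Proof.
move=> C0 NC; apply: (@local_solution _ _ _ (`|d| + C)) => //.
- by rewrite addr_ge0.
- by move=> x y x1 y1; exact: diag_field_lipschitz.
Qed.

End DiagonalField.

(** * Asymptotic stability when all diagonal entries are negative *)

Section Sink.
Context {R : realType} {n : nat}.
Variables (d : 'rV[R]_n.+1) (N : 'rV[R]_n.+1 -> 'rV[R]_n.+1) (C m : R).
Hypotheses (C0 : 0 <= C) (NC : second_order 1 N C).
Hypotheses (m0 : 0 < m) (dm : forall i, d 0 i <= - m).

Let G := diag_field d N.
Let V := @quad R n (fun=> 1).
(** For [|x| < r] the contribution of [N] to the derivative of [V] uses up at most half of the
    linear decay rate [2 * m]. The [+ 1] keeps the denominator positive for [C = 0]. *)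
Let r : R := Num.min 1 (m / (2 * n.+1%:R * C + 1)).

Let den0 : 0 < 2 * n.+1%:R * C + 1.
Proof. by rewrite ltr_wpDl// !mulr_ge0. Qed.

Let r0 : 0 < r.
Proof. by rewrite lt_min ltr01 divr_gt0. Qed.

Let r1 : r <= 1.
Proof. by rewrite ge_min lexx. Qed.

Let norm_le_V x : `|x| ^+ 2 <= V x.
Proof.
have V0 : 0 <= V x by apply: sumr_ge0 => i _; rewrite mul1r sqr_ge0.
rewrite -[V x]sqr_sqrtr// lerXn2r ?nnegrE ?sqrtr_ge0//.
apply: rV_norm_le => [|i]; first exact: sqrtr_ge0.
rewrite -sqrtr_sqr ler_wsqrtr// /V /quad (bigD1 i)//= mul1r lerDl.
by apply: sumr_ge0 => j _; rewrite mul1r sqr_ge0.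
Qed.

Let V_le_norm x : V x <= n.+1%:R * `|x| ^+ 2.
Proof.
rewrite /V /quad; apply: (@le_trans _ _ (\sum_(i < n.+1) `|x| ^+ 2)).
  apply: ler_sum => i _; rewrite mul1r -real_normK ?num_real//.
  by rewrite lerXn2r ?nnegrE ?ler_coord_norm.
by rewrite sumr_const card_ord mulr_natl.
Qed.

(** Bounding [n.+1] by its square avoids a square root in the radius. *)
Let V_lt x (e : R) : 0 < e -> `|x| < e / n.+1%:R -> V x < e ^+ 2.
Proof.
move=> e0; rewrite ltr_pdivlMr// => xe; apply: le_lt_trans (V_le_norm x) _.
apply: (@le_lt_trans _ _ ((`|x| * n.+1%:R) ^+ 2)).
  rewrite exprMn mulrC ler_wpM2l ?sqr_ge0// expr2 ler_peMr//.
  by rewrite ler1n.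
by rewrite ltrXn2r ?nnegrE ?mulr_ge0// ltW.
Qed.

Let lt_V x (e : R) : 0 < e -> V x < e ^+ 2 -> `|x| < e.
Proof.
move=> e0 Vx; rewrite -(@ltr_pXn2r _ 2) ?nnegrE ?(ltW e0)//.
exact: le_lt_trans (norm_le_V x) Vx.
Qed.

Let V_decay (x : 'rV[R]_n.+1) : `|x| < r ->
  \sum_i 1 * (2 * x 0 i * G x 0 i) <= - m * V x.
Proof.
move=> xr; have x1 : `|x| <= 1 by exact/ltW/(lt_le_trans xr).
have NB := second_order_norm NC x1.
apply: (@le_trans _ _ (\sum_(i < n.+1)
   ((- (2 * m)) * (1 * x 0 i ^+ 2) + 2 * C * `|x| * `|x| ^+ 2))).
  apply: ler_sum => i _; rewrite /G diag_fieldE !mul1r.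
  have h1 : x 0 i ^+ 2 * (d 0 i + m) <= 0.
    by rewrite mulr_ge0_le0 ?sqr_ge0//; have := dm i; lra.
  have h2 : x 0 i * N x 0 i <= `|x| * (C * `|x| ^+ 2).
    apply: (le_trans (ler_norm _)); rewrite normrM ler_pM// ?ler_coord_norm//.
    exact: le_trans (ler_coord_norm _ _) NB.
  lra.
rewrite big_split/= -mulr_sumr -[\sum_(i < n.+1) 1 * _]/(V x) sumr_const card_ord.
rewrite -[_ *+ n.+1]mulr_natl.
have xV := norm_le_V x.
have : 2 * n.+1%:R * C * `|x| <= m.
  have : `|x| <= m / (2 * n.+1%:R * C + 1).
    by apply/ltW/(lt_le_trans xr); rewrite ge_min lexx orbT.
  by rewrite ler_pdivlMr//; have := normr_ge0 x; lra.
have V0 : 0 <= V x by apply: le_trans xV; rewrite sqr_ge0.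
move=> /(ler_wpM2r V0) h.
have : 2 * n.+1%:R * C * `|x| * `|x| ^+ 2 <= 2 * n.+1%:R * C * `|x| * V x.
  by rewrite ler_wpM2l// !mulr_ge0.
lra.
Qed.

(** At a first exit from [V < e ^+ 2] the decay up to that time would give [V <= V (x 0) < e ^+ 2].
    The equation is assumed only inside the ball of radius [r], so that cut-off solutions
    qualify. *)
Let trap (x : R -> 'rV[R]_n.+1) (b e : R) : 0 <= b -> 0 < e -> e <= r ->
  {within `[0, b], continuous x} ->
  (forall t : R, 0 < t -> t < b -> `|x t| < r -> is_derive t 1 x (G (x t))) ->
  V (x 0) < e ^+ 2 ->
  V (x b) < e ^+ 2 /\ V (x b) <= V (x 0) * expR (- m * b).
Proof.
move=> b0 e0 er xc dx Vx0.
have decay s : 0 <= s -> s <= b ->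
    (forall t, 0 <= t -> t < s -> V (x t) < e ^+ 2) ->
    V (x s) <= V (x 0) * expR (- m * s).
  move=> s0 sb Vs.
  apply: (@gronwall _ (V \o x) (fun t => \sum_i 1 * (2 * x t 0 i * G (x t) 0 i))) => //.
    apply: within_continuous_quad; apply: continuous_subspaceW xc.
    by apply: subset_itvl; rewrite bnd_simp.
  move=> t t0 ts.
  have xt : `|x t| < r by apply: lt_le_trans er; apply: lt_V => //; exact/Vs/ts/ltW.
  split; last exact: V_decay.
  by apply: is_derive_quad; apply: dx => //; exact: lt_le_trans sb.
have Ve s : 0 <= s -> s <= b -> V (x s) < e ^+ 2.
  move=> s0 sb; rewrite ltNge; apply/negP => Vs.
  have [|T [T0 Ts VT VTe]] := @first_exit _ (V \o x) s (e ^+ 2) s0 _ Vx0 Vs.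
    apply: within_continuous_quad; apply: continuous_subspaceW xc.
    by apply: subset_itvl; rewrite bnd_simp.
  have := decay T (ltW T0) (le_trans Ts sb) VTe.
  move=> /(le_trans VT); rewrite leNgt => /negP; apply.
  apply: le_lt_trans Vx0; rewrite ler_piMr//.
    by apply: le_trans (norm_le_V _); rewrite sqr_ge0.
  by rewrite -expR0 ler_expR mulNr oppr_le0 mulr_ge0// ltW.
split; first exact: Ve.
apply: decay => // t t0 /ltW tb; exact: Ve.
Qed.

Lemma diag_field_sink : asymptotically_stable G 0.
Proof.
have within_b (b : R) (T : \bar R) (x : R -> 'rV[R]_n.+1) : (b%:E < T)%E ->
    {within [set t : R | 0 <= t /\ (t%:E < T)%E], continuous x} ->
    {within `[0, b], continuous x}.
  move=> bT; apply: continuous_subspaceW => t /=.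
  rewrite in_itv/= => /andP[t0 tb]; split=> //.
  by apply: le_lt_trans bT; rewrite lee_fin.
split=> [eps eps0|].
  have e0 : 0 < Num.min eps r by rewrite lt_min eps0.
  exists (Num.min eps r / n.+1%:R); first exact: divr_gt0.
  move=> T x [xc dx]; rewrite subr0 => /(V_lt e0) Vx0 t t0 tT; rewrite subr0.
  apply: (@lt_le_trans _ _ (Num.min eps r)); last by rewrite ge_min lexx.
  apply: lt_V => //.
  apply: (trap t0 e0 _ (within_b _ _ _ tT xc) _ Vx0).1.
    by rewrite ge_min lexx orbT.
  move=> s s0 st _; apply: dx => //; apply: lt_trans tT; by rewrite lte_fin.
exists (r / n.+1%:R); first exact: divr_gt0.
move=> x0; rewrite subr0 => /(V_lt r0) Vx0; split.
  (* The cut-off solution is trapped in the ball where the cut-off has no effect, so it solves the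
     original equation for all time. *)
  have [x [xx0 xc dx]] := diag_field_solution d C0 NC x0.
  rewrite -xx0 in Vx0.
  have xr t : 0 <= t -> `|x t| < r.
    move=> t0; apply: lt_V => //; apply: (trap t0 r0 (lexx _) _ _ Vx0).1.
      by apply: continuous_subspaceW xc => s /=; rewrite in_itv/= => /andP[].
    by move=> s s0 _ xsr; apply: dx => //; exact/ltW/(lt_le_trans xsr).
  exists x; split=> //; split.
    by apply: continuous_subspaceW xc => t /= [].
  by move=> t t0 _; apply: dx => //; apply/ltW/(lt_le_trans (xr _ (ltW t0))).
move=> x [xc dx] xx0; rewrite -xx0 in Vx0.
apply/cvgrPdist_lt => e e0.
have V0 : 0 <= V (x 0) by apply: le_trans (norm_le_V _); rewrite sqr_ge0.
near=> t.
have t0 : 0 <= t by near: t; exact: nbhs_pinfty_ge.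
rewrite sub0r normrN; apply: lt_V => //.
have [_ ] := trap t0 r0 (lexx _) (within_b _ _ _ (ltry _) xc)
  (fun s s0 _ _ => dx s s0 (ltry _)) Vx0.
move=> /le_lt_trans; apply.
rewrite mulNr expRN ltr_pdivrMr ?expR_gt0//.
have e20 : 0 < e ^+ 2 by rewrite exprn_gt0.
(* The bound [1 + m * t <= expR (m * t)] turns the exponential decay into an explicit threshold for
   [t]. *)
apply: (@lt_le_trans _ _ (e ^+ 2 * (1 + m * t))); last first.
  by rewrite ler_wpM2l ?expR_ge1Dx// ltW.
have : V (x 0) / (e ^+ 2 * m) < t by near: t; apply: nbhs_pinfty_gt; exact: num_real.
by rewrite ltr_pdivrMr ?mulr_gt0//; lra.
Unshelve. all: by end_near. Qed.

End Sink.

(** * Instability along one axis when the other directions contract *)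

Section Unstable.
Context {R : realType} {n : nat}.
Variables (d : 'rV[R]_n.+1) (N : 'rV[R]_n.+1 -> 'rV[R]_n.+1).
Variables (i0 : 'I_n.+1) (C m c e1 : R).
Hypotheses (C0 : 0 < C) (NC : second_order 1 N C).
Hypotheses (m0 : 0 < m) (dm : forall j, j != i0 -> d 0 j <= - m).
Hypotheses (c0 : 0 < c) (e10 : 0 < e1).

Let G := diag_field d N.
Let axis (h : R) : 'rV[R]_n.+1 := h *: delta_mx 0 i0.

(** Quadratic growth is weak enough to cover a vanishing eigenvalue as well as a positive one. *)
Hypothesis growth : forall h, 0 < h -> h < e1 -> c * h ^+ 2 <= G (axis h) 0 i0.

(** The aperture [k] gives [C * k <= c / 2], so that moving off the axis costs at most half of the
    growth. The height [e] gives [n.+1 * C * e <= m * k], so that [N] cannot undo the transversal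
    contraction. With the weights [w], the cone is [g < 0]. *)
Let k : R := Num.min 1 (c / (2 * C)).
Let e : R := Num.min 1 (Num.min e1 (m * k / (n.+1%:R * C))).
Let w j : R := if j == i0 then - k ^+ 2 else 1.
Let g := @quad R n w.

Let k0 : 0 < k.
Proof. by rewrite lt_min ltr01 divr_gt0 ?mulr_gt0. Qed.

Let k1 : k <= 1.
Proof. by rewrite ge_min lexx. Qed.

Let kC : C * k <= c / 2.
Proof.
have : k <= c / (2 * C) by rewrite ge_min lexx orbT.
by rewrite ler_pdivlMr ?mulr_gt0//; lra.
Qed.

Let e0 : 0 < e.
Proof. by rewrite !lt_min ltr01 e10 divr_gt0 ?mulr_gt0. Qed.

Let e_le1 : e <= 1.
Proof. by rewrite ge_min lexx. Qed.

Let e_lee1 : e <= e1.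
Proof. by rewrite !ge_min lexx orbT. Qed.

Let eC : n.+1%:R * C * e <= m * k.
Proof.
have : e <= m * k / (n.+1%:R * C) by rewrite !ge_min lexx !orbT.
by rewrite ler_pdivlMr ?mulr_gt0// mulrC.
Qed.

Let axis_i0 h : axis h 0 i0 = h.
Proof. by rewrite !mxE !eqxx mulr1. Qed.

Let axis_other h j : j != i0 -> axis h 0 j = 0.
Proof. by move=> ji0; rewrite !mxE eqxx (negPf ji0) mulr0. Qed.

Let axis_norm h : 0 <= h -> `|axis h| <= h.
Proof.
move=> h0; apply: rV_norm_le => // j.
have [->|ji0] := eqVneq j i0; first by rewrite axis_i0 ger0_norm.
by rewrite axis_other// normr0.
Qed.

(* The part of the cone [|w| < k h] around the axis ([h] the axial and [w] the
   transversal component) where [h < e]. *)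
Section Cone.
Variable x : 'rV[R]_n.+1.
Hypotheses (gx : g x < 0) (h0 : 0 < x 0 i0) (he : x 0 i0 < e).
Let h := x 0 i0.

Let cone_coord j : j != i0 -> `|x 0 j| <= k * h.
Proof.
move=> ji0; have kh0 : 0 <= k * h by rewrite ltW// mulr_gt0.
rewrite -(ler_pXn2r (ltn0Sn 1)) ?nnegrE// real_normK ?num_real//.
have : g x = - k ^+ 2 * h ^+ 2 + (x 0 j ^+ 2 +
    \sum_(i < n.+1 | (i != i0) && (i != j)) w i * x 0 i ^+ 2).
  by rewrite /g /quad (bigD1 i0)//= (bigD1 j)//= /w eqxx (negPf ji0) mul1r.
have : 0 <= \sum_(i < n.+1 | (i != i0) && (i != j)) w i * x 0 i ^+ 2.
  by apply: sumr_ge0 => i /andP[ii0 _]; rewrite /w (negPf ii0) mul1r sqr_ge0.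
by rewrite exprMn; move: gx => /= ?; lra.
Qed.

Let cone_norm : `|x| <= h.
Proof.
apply: rV_norm_le => [|j]; first exact: ltW.
have [->|ji0] := eqVneq j i0; first by rewrite gtr0_norm.
by apply: le_trans (cone_coord ji0) _; rewrite ler_piMl// ltW.
Qed.

Let h1 : h <= 1.
Proof. exact/ltW/(lt_le_trans he). Qed.

(** Comparison with the axis point of the same height [h]: the linear parts agree in direction [i0],
    and the values of [N] differ by at most [C * h * (k * h)]. *)
Lemma cone_growth : c / 2 * h ^+ 2 <= G x 0 i0.
Proof.
have a := growth h0 (lt_le_trans he e_lee1).
have kh : `|x - axis h| <= k * h.
  apply: rV_norm_le => [|j]; first by rewrite ltW// mulr_gt0.
  rewrite !mxE eqxx/=; have [->|ji0] := eqVneq j i0.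
    by rewrite mulr1 subrr normr0 ltW// mulr_gt0.
  by rewrite mulr0 subr0 cone_coord.
have [_ NC'] := NC.
have := NC' h x (axis h) h1 cone_norm (axis_norm (ltW h0)).
move=> /(le_trans (ler_coord_norm _ i0)); rewrite mxE [X in _ + X]mxE.
move: a; rewrite /G !diag_fieldE axis_i0 ler_norml => a /andP[b _].
have : C * h * `|x - axis h| <= C * h * (k * h).
  by rewrite ler_wpM2l// ltW// mulr_gt0.
have : C * k * h ^+ 2 <= c / 2 * h ^+ 2 by rewrite ler_wpM2r// sqr_ge0.
by rewrite -/h in a b *; lra.
Qed.

(** Since [h] grows, the axial term of the derivative is nonpositive, which leaves
    [2 * m * k ^+ 2 * h ^+ 2] to spare. This absorbs the transversal contributions of [N], by the
    choice of [e]. *)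
Lemma cone_contract : \sum_i w i * (2 * x 0 i * G x 0 i) <= - (2 * m) * g x.
Proof.
have NB := second_order_norm NC (le_trans cone_norm h1).
have Nx j : `|N x 0 j| <= C * h ^+ 2.
  apply: (le_trans (ler_coord_norm _ _)); apply: (le_trans NB).
  rewrite ler_wpM2l ?(ltW C0)//.
  by rewrite lerXn2r ?nnegrE ?cone_norm// ltW.
rewrite /g /quad (bigD1 i0)//= [X in _ <= _ * X](bigD1 i0)//= mulrDr.
apply: (@le_trans _ _ (- (2 * m) * (w i0 * x 0 i0 ^+ 2) - 2 * m * k ^+ 2 * h ^+ 2 +
   \sum_(i < n.+1 | i != i0) (- (2 * m) * (w i * x 0 i ^+ 2)
      + 2 * (k * h) * (C * h ^+ 2)))).
  apply: lerD.
    rewrite /w eqxx -/h.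
    have : 0 <= k ^+ 2 * (h * G x 0 i0).
      rewrite mulr_ge0 ?sqr_ge0// mulr_ge0 ?(ltW h0)//; apply: le_trans cone_growth.
      by rewrite mulr_ge0 ?sqr_ge0 ?divr_ge0// ltW.
    lra.
  apply: ler_sum => j ji0; rewrite /w (negPf ji0) /G diag_fieldE !mul1r.
  have a1 : x 0 j ^+ 2 * (d 0 j + m) <= 0.
    by rewrite mulr_ge0_le0 ?sqr_ge0//; have := dm ji0; lra.
  have a2 : x 0 j * N x 0 j <= (k * h) * (C * h ^+ 2).
    by apply: (le_trans (ler_norm _)); rewrite normrM ler_pM// cone_coord.
  lra.
rewrite big_split/= -mulr_sumr.
have : \sum_(i < n.+1 | i != i0) 2 * (k * h) * (C * h ^+ 2) <=
    n.+1%:R * (2 * (k * h) * (C * h ^+ 2)).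
  have q0 : 0 <= 2 * (k * h) * (C * h ^+ 2) by rewrite ltW// !mulr_gt0// exprn_gt0.
  rewrite sumr_const -[X in X <= _]mulr_natl ler_wpM2r// ler_nat.
  by rewrite -[X in (_ <= X)%N]card_ord max_card.
have : n.+1%:R * C * h * (k * h ^+ 2) <= m * k * (k * h ^+ 2).
  apply: ler_wpM2r; first by rewrite mulr_ge0 ?sqr_ge0// ltW.
  by apply: le_trans eC; rewrite ler_wpM2l ?mulr_ge0// ltW.
lra.
Qed.

End Cone.

Lemma diag_field_unstable : unstable G 0.
Proof.
move=> /(_ (e / 2)) []; first exact: divr_gt0.
move=> delta delta0 stable.
(* The factor [4] puts the starting point strictly below both [delta] and [e / 2]. *)
pose h0 := Num.min delta e / 4.
have md0 : 0 < Num.min delta e by rewrite lt_min delta0.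
have h00 : 0 < h0 by rewrite divr_gt0.
have h0d : h0 < delta.
  have : Num.min delta e <= delta by rewrite ge_min lexx.
  by rewrite /h0; lra.
have h0e : h0 < e / 2.
  have : Num.min delta e <= e by rewrite ge_min lexx orbT.
  by rewrite /h0; lra.
have [x [xx0 xc dx]] := diag_field_solution d (ltW C0) NC (axis h0).
have xcb (b : R) : {within `[0, b], continuous x}.
  by apply: continuous_subspaceW xc => s /=; rewrite in_itv/= => /andP[].
have nc (b : R) : {within `[0, b], continuous (fun t => `|x t|)}.
  move=> t; apply: (@continuous_comp (subspace `[0, b]%classic) _ _ x (fun y => `|y|)).
    exact: xcb.
  exact: norm_continuous.
have ic (b : R) : {within `[0, b], continuous (fun t => x t 0 i0)}.
  move=> t; apply: (@continuous_comp (subspace `[0, b]%classic) _ _ x (fun y => y 0 i0)).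
    exact: xcb.
  exact: coord_continuous.
have nx0 : `|x 0| <= h0 by rewrite xx0 axis_norm// ltW.
(* Only while [|x t| <= 1] is [x] known to solve the equation, so stability is applied on [[0, T[]
   with [T] the first time at which the norm reaches [e]; before [T] the norm takes the value
   [e / 2], a contradiction. *)
have xe (t : R) : 0 <= t -> `|x t| < e.
  move=> t0; rewrite ltNge; apply/negP => xte.
  have nx0e : `|x 0| < e by apply: (le_lt_trans nx0); lra.
  have [T [T0 _ eT Te]] := first_exit t0 (nc t) nx0e xte.
  have sol : solves_on G T%:E x.
    split=> [|s s0]; first by apply: continuous_subspaceW xc => s /= [].
    rewrite lte_fin => sT; apply: dx => //.
    exact: le_trans (ltW (Te s (ltW s0) sT)) e_le1.
  have [|s] := IVT (ltW T0) (nc T) (_ : _ <= e / 2 <= _).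
    rewrite ge_min le_max (le_trans nx0 (ltW h0e))/= (le_trans _ eT) ?orbT//.
    lra.
  rewrite in_itv/= => /andP[s0 sT] xs.
  have {}sT : s < T.
    rewrite lt_neqAle sT andbT; apply/eqP => sT'; rewrite sT' in xs; lra.
  have := stable T%:E x sol; rewrite !subr0 => /(_ (le_lt_trans nx0 h0d) s s0).
  by rewrite lte_fin subr0 xs ltxx => /(_ sT).
have xi0 (t : R) : 0 <= t -> x t 0 i0 < e.
  move=> t0; apply: le_lt_trans (xe t t0); apply: le_trans (ler_norm _) _.
  exact: ler_coord_norm.
have dG (t : R) : 0 < t -> is_derive t 1 x (G (x t)).
  by move=> t0; apply: dx => //; exact: le_trans (ltW (xe t (ltW t0))) e_le1.
have g0 : g (x 0) < 0.
  rewrite xx0 /g /quad (bigD1 i0)//= big1 => [|j ji0].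
    by rewrite axis_i0 /w eqxx addr0 mulNr oppr_lt0 mulr_gt0 ?exprn_gt0.
  by rewrite axis_other// expr0n mulr0.
(* The maximum merges two exit conditions, leaving the cone and sinking to height [h0 / 2], into a
   single first exit time. *)
have cone (t : R) : 0 <= t -> Num.max (g (x t)) (h0 / 2 - x t 0 i0) < 0.
  move=> t0; rewrite ltNge; apply/negP => xt.
  have [||T [T0 _ + Tcone]] := @first_exit _
    (fun s => Num.max (g (x s)) (h0 / 2 - x s 0 i0)) t 0 t0 _ _ xt.
  - move=> s; apply: (@continuous_max R (subspace `[0, t]%classic)
      (g \o x) (fun s => h0 / 2 - x s 0 i0)).
      by apply: within_continuous_quad; exact: xcb.
    apply: continuousB; first exact: cst_continuous.
    exact: ic.
  - by rewrite gt_max g0/= xx0 axis_i0; lra.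
  have inside s : 0 < s -> s < T -> [/\ g (x s) < 0, 0 < x s 0 i0 & x s 0 i0 < e].
    move=> s0 sT; have := Tcone s (ltW s0) sT; rewrite gt_max => /andP[? ?].
    by split; [|lra|exact/xi0/ltW].
  (* Neither condition can fail at [T]: contraction keeps [g] negative, and the case [c = 0] of
     [gronwall] keeps the height at least [h0]. *)
  rewrite leNgt gt_max => /negP; apply; apply/andP; split.
    apply: (@le_lt_trans _ _ (g (x 0) * expR (- (2 * m) * T))); last first.
      by rewrite nmulr_rlt0// expR_gt0.
    apply: (@gronwall _ (g \o x) (fun s => \sum_i w i * (2 * x s 0 i * G (x s) 0 i))).
    - exact: ltW.
    - by apply: within_continuous_quad; exact: xcb.
    - move=> s s0 sT; have [gs hs hse] := inside s s0 sT; split.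
        by apply: is_derive_quad; exact: dG.
      exact: cone_contract.
  have := @gronwall _ (fun s => - x s 0 i0) (fun s => - G (x s) 0 i0) 0 T (ltW T0).
  rewrite oppr0 mul0r expR0 mulr1 xx0 axis_i0 => H.
  suff : - x T 0 i0 <= - h0 by lra.
  apply: H => [s|s s0 sT].
    by apply: continuousN; exact: ic.
  have [gs hs hse] := inside s s0 sT; split.
    by apply: is_deriveN; apply: (rV_derive _ _ _).1; exact: dG.
  rewrite mul0r oppr_le0; apply: le_trans (cone_growth gs hs hse).
  by rewrite mulr_ge0 ?sqr_ge0 ?divr_ge0// ltW.
(* Above height [h0 / 2] the axial speed is at least [q], so by time [e / q] the height would exceed
   [e]. *)
pose q := c / 2 * (h0 / 2) ^+ 2.
have q0 : 0 < q by rewrite mulr_gt0 ?divr_gt0// exprn_gt0// divr_gt0.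
have b0 : 0 <= e / q by rewrite ltW// divr_gt0.
have := @gronwall _ (fun s => q * s - x s 0 i0) (fun s => q - G (x s) 0 i0)
  0 (e / q) b0.
rewrite oppr0 !mul0r expR0 mulr1 mulr0 xx0 axis_i0 sub0r mulrCA divff ?gt_eqF// mulr1.
move=> H; suff : e - x (e / q) 0 i0 <= - h0 by have := xi0 _ b0; lra.
apply: H => [s|s s0 sq].
  apply: continuousB; last exact: ic.
  by apply: continuous_subspaceT => {}s; exact: mulrl_continuous.
have := cone s (ltW s0); rewrite gt_max => /andP[gs hs]; split.
  apply: is_deriveB; first exact: is_derive_scale.
  by apply: (rV_derive _ _ _).1; exact: dG.
have hs0 : 0 < x s 0 i0 by lra.
rewrite mul0r subr_le0; apply: le_trans (cone_growth gs hs0 (xi0 _ (ltW s0))).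
rewrite ler_wpM2l ?divr_ge0 ?(ltW c0)// lerXn2r ?nnegrE ?ltW ?divr_gt0//.
lra.
Qed.

End Unstable.

(** For [h < d 0 i0 / (C + 1)] the linear term [d 0 i0 * h] dominates [(C + 1) * h ^+ 2]; after
    subtracting the remainder, growth holds with constant [1]. *)
Lemma diag_field_unstable_pos {R : realType} {n : nat} (d : 'rV[R]_n.+1)
    (N : 'rV[R]_n.+1 -> 'rV[R]_n.+1) (i0 : 'I_n.+1) (C m : R) :
  0 < C -> second_order 1 N C -> 0 < m ->
  (forall j, j != i0 -> d 0 j <= - m) -> 0 < d 0 i0 ->
  unstable (diag_field d N) 0.
Proof.
move=> C0 NC m0 dm di0; have C1 : 0 < C + 1 by rewrite ltr_wpDl// ltW.
apply: (@diag_field_unstable _ _ d N i0 C m 1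
  (Num.min 1 (d 0 i0 / (C + 1)))) => //.
  by rewrite lt_min ltr01 divr_gt0.
move=> h h0; rewrite lt_min => /andP[h1].
rewrite ltr_pdivlMr// => hC.
have axis_norm : `|h *: delta_mx 0 i0 : 'rV[R]_n.+1| <= h.
  apply: rV_norm_le => [|j]; first exact: ltW.
  rewrite !mxE eqxx/=; case: (j == i0); first by rewrite mulr1 gtr0_norm.
  by rewrite mulr0 normr0 ltW.
have := second_order_norm NC (le_trans axis_norm (ltW h1)).
move=> /(le_trans (ler_coord_norm _ i0)).
have axisE : (h *: delta_mx 0 i0 : 'rV[R]_n.+1) 0 i0 = h.
  by rewrite !mxE !eqxx mulr1.
rewrite diag_fieldE axisE.
rewrite ler_norml => /andP[b _].
have : C * `|h *: delta_mx 0 i0 : 'rV[R]_n.+1| ^+ 2 <= C * h ^+ 2.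
  by rewrite ler_wpM2l ?(ltW C0)// lerXn2r ?nnegrE// ltW.
have : h * (h * (C + 1)) <= h * d 0 i0 by rewrite ler_wpM2l// ltW.
lra.
Qed.

(** * Affine changes of coordinates and linearization *)

Section LinearMaps.
Context {R : realType} {n p : nat} (A : 'M[R]_(n.+1, p.+1)).

Lemma mulmx_norm_le (x : 'rV[R]_n.+1) : `|x *m A| <= n.+1%:R * `|A| * `|x|.
Proof.
apply: rV_norm_le => [|j]; first by rewrite !mulr_ge0.
rewrite mxE; apply: (le_trans (ler_norm_sum _ _ _)).
apply: (@le_trans _ _ (\sum_(i < n.+1) `|A| * `|x|)).
  by apply: ler_sum => i _; rewrite normrM mulrC ler_pM// ler_entry_norm.
by rewrite sumr_const card_ord -[_ *+ n.+1]mulr_natl mulrA.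
Qed.

(** The constant is made positive so that radii can be divided by it. *)
Lemma mulmx_bounded :
  exists2 K : R, 0 < K & forall x : 'rV[R]_n.+1, `|x *m A| <= K * `|x|.
Proof.
exists (n.+1%:R * `|A| + 1) => [|x]; first by rewrite ltr_wpDl// mulr_ge0.
by apply: le_trans (mulmx_norm_le x) _; rewrite ler_wpM2r// lerDl.
Qed.

Lemma affine_continuous (u : 'rV[R]_n.+1) (v : 'rV[R]_p.+1) :
  continuous (fun x : 'rV[R]_n.+1 => (x - u) *m A + v).
Proof.
have [K K0 KA] := mulmx_bounded.
move=> x; suff : {for x, continuous (fun x : 'rV[R]_n.+1 => (x - u) *m A + v)} by [].
apply/(@cvgrPdist_lt _ _ _ (nbhs x)) => e e0; apply/nbhs_ballP.
exists (e / K); first exact: divr_gt0.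
move=> y; rewrite -ball_normE/= ltr_pdivlMr// => xy.
rewrite opprD addrACA subrr addr0 -mulmxBl opprB addrA subrK.
by apply: le_lt_trans (KA _) _; rewrite mulrC.
Qed.

Lemma mulmxr_continuous : continuous (mulmxr A : 'rV[R]_n.+1 -> 'rV[R]_p.+1).
Proof.
rewrite (_ : (mulmxr A : _ -> _) = (fun x => (x - 0) *m A + 0)).
  exact: affine_continuous.
by apply/funext => x; rewrite subr0 addr0.
Qed.

Lemma is_derive_mulmx (x : R -> 'rV[R]_n.+1) (t : R) v :
  is_derive t 1 x v -> is_derive t 1 (fun s => x s *m A) (v *m A).
Proof.
move=> /rV_derive dx; apply/rV_derive => j; rewrite mxE.
rewrite (_ : (fun s => _) = \sum_k (A k j \*: (fun s => x s 0 k))); last first.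
  apply/funext => s; rewrite mxE fct_sumE; apply: eq_bigr => k _.
  by rewrite /GRing.scale/= mulrC.
apply: is_derive_sum => k; rewrite [v 0 k * _]mulrC.
exact: is_deriveZ (dx k).
Qed.

End LinearMaps.

(** * Invariance of stability under affine conjugacy *)

Section AffineConjugacy.
Context {R : realType} {n : nat}.
Implicit Types (F G : 'rV[R]_n.+1 -> 'rV[R]_n.+1) (p q : 'rV[R]_n.+1).
Implicit Types (P Q : 'M[R]_n.+1).

(** The substitution [y = (x - p) *m P + q] carries solutions of [F] to solutions of [G] and the
    point [p] to [q]. *)
Definition affine_conj F p G q P :=
  forall x, F x *m P = G ((x - p) *m P + q).

Lemma affine_conj_sym F p G q P Q : Q *m P = 1%:M -> P *m Q = 1%:M ->
  affine_conj F p G q P -> affine_conj G q F p Q.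
Proof.
move=> QP PQ FG y; have := FG ((y - q) *m Q + p).
rewrite addrK -mulmxA QP mulmx1 subrK => <-.
by rewrite -mulmxA PQ mulmx1.
Qed.

Lemma solves_on_affine F p G q P (T : \bar R) x : affine_conj F p G q P ->
  solves_on F T x -> solves_on G T (fun t => (x t - p) *m P + q).
Proof.
move=> FG [xc dx]; split.
  move=> t; apply: (@continuous_comp (subspace _) _ _ x
    (fun y => (y - p) *m P + q)); first exact: xc.
  exact: affine_continuous.
move=> t t0 tT; rewrite -FG; have dxt := dx t t0 tT.
rewrite -[F (x t) *m P]addr0; apply: is_deriveD.
apply: is_derive_mulmx; rewrite -[F (x t)]subr0; exact: is_deriveB.
Qed.

Section Transfer.
Variables (F G : 'rV[R]_n.+1 -> 'rV[R]_n.+1) (p q : 'rV[R]_n.+1).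
Variables (P Q : 'M[R]_n.+1).
Hypotheses (QP : Q *m P = 1%:M) (PQ : P *m Q = 1%:M).
Hypothesis FG : affine_conj F p G q P.

Let back x : ((x - p) *m P + q - q) *m Q = x - p.
Proof. by rewrite addrK -mulmxA PQ mulmx1. Qed.

Lemma lyapunov_stable_affine : lyapunov_stable G q -> lyapunov_stable F p.
Proof.
have [K K0 KP] := mulmx_bounded P; have [K' K'0 KQ] := mulmx_bounded Q.
move=> Gs eps eps0; have [|delta d0 Gd] := Gs (eps / K'); first exact: divr_gt0.
exists (delta / K); first exact: divr_gt0.
move=> T x Fx x0 t t0 tT.
have := Gd T _ (solves_on_affine FG Fx) _ t t0 tT.
rewrite !addrK ltr_pdivlMr// => y.
rewrite -[x t - p]back; apply: (le_lt_trans (KQ _)); rewrite addrK mulrC.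
apply: y; apply: (le_lt_trans (KP _)).
by rewrite mulrC -ltr_pdivlMr.
Qed.

Lemma asymptotically_stable_affine :
  asymptotically_stable G q -> asymptotically_stable F p.
Proof.
move=> [Gs [delta d0 Gd]]; split; first exact: lyapunov_stable_affine.
have [K K0 KP] := mulmx_bounded P; have [K' K'0 KQ] := mulmx_bounded Q.
exists (delta / K); first exact: divr_gt0.
move=> x0 x0p; have [|[y [Gy y0]] Gcv] := Gd ((x0 - p) *m P + q).
  rewrite addrK; apply: (le_lt_trans (KP _)).
  by rewrite mulrC -ltr_pdivlMr.
split.
  exists (fun t => (y t - q) *m Q + p); split.
    by apply: solves_on_affine Gy; exact: affine_conj_sym FG.
  by rewrite y0 back subrK.
move=> x Fx xx0; have := Gcv _ (solves_on_affine FG Fx).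
rewrite xx0 => /(_ erefl) /cvgrPdist_lt ycv.
apply/cvgrPdist_lt => e e0; have := ycv (e / K').
rewrite divr_gt0// => /(_ isT); apply: filterS => t.
rewrite distrC addrK ltr_pdivlMr// => xt.
rewrite distrC -[x t - p]back; apply: (le_lt_trans (KQ _)).
by rewrite addrK mulrC.
Qed.

End Transfer.

Lemma unstable_affine F G p q P Q : Q *m P = 1%:M -> P *m Q = 1%:M ->
  affine_conj F p G q P -> unstable G q -> unstable F p.
Proof.
move=> QP PQ FG Gu Fs; apply: Gu.
exact: lyapunov_stable_affine QP (affine_conj_sym QP PQ FG) Fs.
Qed.

End AffineConjugacy.

(** * Jacobian, diagonal form and spectrum of the linear part *)

Section Linearization.
Context {R : realType} {n : nat}.
Variables (F N : 'rV[R]_n.+1 -> 'rV[R]_n.+1) (p : 'rV[R]_n.+1).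
Variable A : 'M[R]_n.+1.
Hypothesis FE : forall x, F (p + x) = x *m A + N x.

(** A second-order remainder is [o(|x|)], so uniqueness of the differential identifies the linear
    part. *)
Lemma jacobian_linearization r C : 0 < r -> 0 <= C -> second_order r N C ->
  jacobian F p = A.
Proof.
move=> r0 C0 NC; have [N0 _] := NC.
have Fp : F p = 0 by rewrite -[p]addr0 FE mul0mx N0 addr0.
have -> : jacobian F p = lin1_mx (mulmxr A); last first.
  by apply/matrixP => i j; rewrite mxE /= -rowE mxE.
congr lin1_mx; apply: diff_unique; first exact: mulmxr_continuous.
apply/eqaddoP => e e0.
have eC : 0 < e / (C + 1) by rewrite divr_gt0// ltr_wpDl.
have near_r := @nbhs0_le _ 'rV[R]_n.+1 r r0.
have near_e := @nbhs0_le _ 'rV[R]_n.+1 _ eC.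
apply: filterS2 near_r near_e => x xr xe.
rewrite -[X in `|X|]/(F (x + p) - (F p + x *m A)) [x + p]addrC FE Fp add0r.
rewrite addrAC subrr add0r.
apply: (le_trans (second_order_norm NC xr)).
rewrite expr2 mulrA ler_wpM2r//.
move: xe; rewrite ler_pdivlMr ?ltr_wpDl//; apply: le_trans.
by rewrite mulrC ler_wpM2l// lerDl.
Qed.

Variables (P Q : 'M[R]_n.+1) (d : 'rV[R]_n.+1).
Hypotheses (QP : Q *m P = 1%:M) (PQ : P *m Q = 1%:M).
Hypothesis QAP : Q *m A *m P = diag_mx d.

Definition diag_remainder (y : 'rV[R]_n.+1) := N (y *m Q) *m P.

Lemma diag_field_conj : affine_conj F p (diag_field d diag_remainder) 0 P.
Proof.
move=> x; have := FE (x - p); rewrite addrC subrK => ->.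
rewrite addr0 /diag_field /diag_remainder mulmxDl -QAP !mulmxA.
by rewrite -[_ *m P *m Q]mulmxA PQ mulmx1.
Qed.

(** Every radius is allowed in the hypothesis because [Q] maps the unit ball into the ball of radius
    [K'], which need not be small. In the resulting constant, one [K'] comes from the radius, the
    other from the difference of the arguments. *)
Lemma second_order_diag_remainder :
  (forall r, 0 < r -> exists2 C, 0 <= C & second_order r N C) ->
  exists2 C, 0 < C & second_order 1 diag_remainder C.
Proof.
move=> NC; have [K K0 KP] := mulmx_bounded P; have [K' K'0 KQ] := mulmx_bounded Q.
have [C C0 [N0 NCK]] := NC K' K'0.
exists (K * (C * K' ^+ 2) + 1).
  by rewrite ltr_wpDl// mulr_ge0 ?(ltW K0)// mulr_ge0 ?sqr_ge0.
split=> [|rho x y rho1 xr yr]; first by rewrite /diag_remainder mul0mx N0 mul0mx.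
rewrite /diag_remainder -mulmxBl; apply: (le_trans (KP _)).
have bnd (z : 'rV[R]_n.+1) : `|z| <= rho -> `|z *m Q| <= K' * rho.
  by move=> zr; apply: (le_trans (KQ z)); rewrite ler_wpM2l// ltW.
have rho0 : 0 <= rho by exact: le_trans (normr_ge0 x) xr.
have := NCK (K' * rho) (x *m Q) (y *m Q) _ (bnd _ xr) (bnd _ yr).
rewrite ger_pMr// => /(_ rho1); rewrite -mulmxBl => h.
have := ler_wpM2l (ltW K0) h => /le_trans; apply.
have := ler_wpM2l _ (KQ (x - y)) => /(_ (K * (C * (K' * rho)))).
rewrite !mulr_ge0 ?(ltW K0) ?(ltW K'0)// => /(_ isT) h2.
have := mulr_ge0 rho0 (normr_ge0 (x - y)).
lra.
Qed.

(** Similar matrices have the same characteristic polynomial: [Q *m P = 1] moves the scalar ['X]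
    through the conjugation. *)
Lemma char_poly_diagonalized : char_poly A = \prod_i ('X - (d 0 i)%:P).
Proof.
have -> : \prod_i ('X - (d 0 i)%:P) = char_poly (diag_mx d).
  rewrite char_poly_trig ?diag_mx_is_trig//.
  by apply: eq_bigr => i _; rewrite mxE eqxx mulr1n.
rewrite /char_poly -QAP.
have -> : char_poly_mx (Q *m A *m P) =
    map_mx polyC Q *m char_poly_mx A *m map_mx polyC P.
  rewrite /char_poly_mx mulmxBr mulmxBl !map_mxM; congr (_ - _).
  by rewrite scalar_mxC -mulmxA -map_mxM QP map_mx1 mulmx1.
rewrite !det_mulmx mulrAC -det_mulmx -map_mxM QP map_mx1 det1 mul1r//.
Qed.

End Linearization.

(** * The critical point *)

Section PolynomialOrder.
Context {R : realType} {n : nat} (r : R).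
Implicit Types f g : 'rV[R]_n.+1 -> R.

(** Lipschitz forms of [O(|x|)] and [O(|x|^2)]. Their closure rules allow a polynomial remainder to
    be estimated term by term. *)
Definition order1 f := f 0 = 0 /\ exists2 C, 0 <= C &
  forall x y, `|x| <= r -> `|y| <= r -> `|f x - f y| <= C * `|x - y|.

Definition order2 f := f 0 = 0 /\ exists2 C, 0 <= C &
  forall (rho : R) x y, rho <= r -> `|x| <= rho -> `|y| <= rho ->
    `|f x - f y| <= C * rho * `|x - y|.

Lemma order1_coord i : order1 (fun x => x 0 i).
Proof.
split; first by rewrite mxE.
exists 1 => // x y _ _; rewrite mul1r.
by have := ler_coord_norm (x - y) i; rewrite !mxE.
Qed.

Lemma order1D f g : order1 f -> order1 g -> order1 (fun x => f x + g x).
Proof.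
move=> [f0 [Cf Cf0 fC]] [g0 [Cg Cg0 gC]]; split; first by rewrite f0 g0 addr0.
exists (Cf + Cg) => [|x y xr yr]; first exact: addr_ge0.
by rewrite opprD addrACA mulrDl (le_trans (ler_normD _ _))// lerD ?fC ?gC.
Qed.

Lemma order1Z c f : order1 f -> order1 (fun x => c * f x).
Proof.
move=> [f0 [C C0 fC]]; split; first by rewrite f0 mulr0.
exists (`|c| * C) => [|x y xr yr]; first exact: mulr_ge0.
by rewrite -mulrBr normrM -mulrA ler_wpM2l// fC.
Qed.

Lemma order2D f g : order2 f -> order2 g -> order2 (fun x => f x + g x).
Proof.
move=> [f0 [Cf Cf0 fC]] [g0 [Cg Cg0 gC]]; split; first by rewrite f0 g0 addr0.
exists (Cf + Cg) => [|rho x y rhor xr yr]; first exact: addr_ge0.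
by rewrite opprD addrACA !mulrDl (le_trans (ler_normD _ _))// lerD ?fC ?gC.
Qed.

Lemma order2Z c f : order2 f -> order2 (fun x => c * f x).
Proof.
move=> [f0 [C C0 fC]]; split; first by rewrite f0 mulr0.
exists (`|c| * C) => [|rho x y rhor xr yr]; first exact: mulr_ge0.
by rewrite -mulrBr normrM -!mulrA ler_wpM2l// mulrA fC.
Qed.

(** In the product rule for differences, one factor is of size [rho] and the other is Lipschitz. *)
Lemma order2M f g : order1 f -> order1 g -> order2 (fun x => f x * g x).
Proof.
move=> [f0 [Cf Cf0 fC]] [g0 [Cg Cg0 gC]]; split; first by rewrite f0 mul0r.
exists (2 * (Cf * Cg)) => [|rho x y rhor xr yr]; first by rewrite !mulr_ge0.
have xr' := le_trans xr rhor; have yr' := le_trans yr rhor.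
have r0 : `|0 : 'rV[R]_n.+1| <= r by rewrite normr0; exact: le_trans xr'.
have fx : `|f x| <= Cf * rho.
  have := fC x 0 xr' r0; rewrite f0 !subr0 => /le_trans; apply.
  by rewrite ler_wpM2l.
have gy : `|g y| <= Cg * rho.
  have := gC y 0 yr' r0; rewrite g0 !subr0 => /le_trans; apply.
  by rewrite ler_wpM2l.
have -> : f x * g x - f y * g y = f x * (g x - g y) + g y * (f x - f y) by ring.
apply: (le_trans (ler_normD _ _)); rewrite !normrM.
have h1 := ler_pM (normr_ge0 _) (normr_ge0 _) fx (gC x y xr' yr').
have h2 := ler_pM (normr_ge0 _) (normr_ge0 _) gy (fC x y xr' yr').
by lra.
Qed.

Lemma order2_order1 f : order2 f -> order1 f.
Proof.
move=> [f0 [C C0 fC]]; split => //.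
(* Taking [rho = r] suffices; for [r < 0] the ball is empty. *)
have [r0|r0] := leP 0 r.
  by exists (C * r) => [|x y xr yr]; [exact: mulr_ge0|exact: fC].
by exists 0 => // x y xr _; have := le_lt_trans (le_trans (normr_ge0 x) xr) r0;
  rewrite ltxx.
Qed.

End PolynomialOrder.

Section Rows3.
Context {R : realType}.
Implicit Types a b c : R.

Definition mat3 (s : seq (seq R)) : 'M[R]_3 := \matrix_(i, j) (nth [::] s i)`_j.

Lemma ord3P (P : 'I_3 -> Prop) : P 0 -> P 1 -> P 2 -> forall i, P i.
Proof.
move=> P0 P1 P2' [[|[|[|//]]] i3].
- by rewrite (_ : Ordinal i3 = 0)//; exact: val_inj.
- by rewrite (_ : Ordinal i3 = 1)//; exact: val_inj.
- by rewrite (_ : Ordinal i3 = 2)//; exact: val_inj.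
Qed.

Lemma sum3 (f : 'I_3 -> R) : \sum_i f i = f 0 + f 1 + f 2.
Proof.
rewrite !big_ord_recl big_ord0 addr0 addrA.
by congr (_ + f _ + f _); exact: val_inj.
Qed.

Lemma row3_eq (x y : 'rV[R]_3) :
  x 0 0 = y 0 0 -> x 0 1 = y 0 1 -> x 0 2 = y 0 2 -> x = y.
Proof. by move=> *; apply/rowP; exact: ord3P. Qed.

Lemma second_order_row3 (r : R) (f g h : 'rV[R]_3 -> R) :
  order2 r f -> order2 r g -> order2 r h ->
  exists2 C, 0 <= C & second_order r (fun x => row3 (f x) (g x) (h x)) C.
Proof.
move=> [f0 [Cf Cf0 fC]] [g0 [Cg Cg0 gC]] [h0 [Ch Ch0 hC]].
exists (Cf + Cg + Ch); first by rewrite !addr_ge0.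
split; first by apply: row3_eq; rewrite !mxE/=.
move=> rho x y rhor xr yr.
have rho0 : 0 <= rho by exact: le_trans (normr_ge0 x) xr.
have q0 : 0 <= rho * `|x - y| by rewrite mulr_ge0.
have qf := mulr_ge0 Cf0 q0; have qg := mulr_ge0 Cg0 q0; have qh := mulr_ge0 Ch0 q0.
have c0 : 0 <= (Cf + Cg + Ch) * rho * `|x - y|.
  by rewrite -mulrA mulr_ge0// !addr_ge0.
apply: (rV_norm_le c0) => i.
have := fC rho x y rhor xr yr; have := gC rho x y rhor xr yr.
have := hC rho x y rhor xr yr.
by elim/ord3P: i; rewrite !mxE /=; lra.
Qed.

End Rows3.

(** * Explicit diagonalization and remainder at [P2] *)

Section CriticalPoint.
Context {R : realType} (l : R).
Hypotheses (l0 : 0 <= l) (l6 : l < Num.sqrt 6).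

Let s : R := Num.sqrt 3.
Let U : R := Num.sqrt ((6 - l ^+ 2) / 18).
(** [D] is the gap between the simple eigenvalue and [- 3 * U ^+ 2], and also the determinant of the
    lower right block of [toeig]. *)
Let D : R := U ^+ 2 + 2 * l ^+ 2 / 9.

Let s2 : s ^+ 2 = 3.
Proof. by rewrite sqr_sqrtr. Qed.

Let s0 : s != 0.
Proof. by rewrite gt_eqF// sqrtr_gt0. Qed.

Let l2_lt6 : l ^+ 2 < 6.
Proof.
rewrite -[6 : R]sqr_sqrtr// ltr_pXn2r// ?nnegrE ?sqrtr_ge0//.
Qed.

Let U0 : 0 < U.
Proof. by rewrite sqrtr_gt0 divr_gt0// subr_gt0. Qed.

Let U2 : U ^+ 2 = (6 - l ^+ 2) / 18.
Proof. by rewrite sqr_sqrtr// divr_ge0// subr_ge0 ltW. Qed.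

Let D0 : D != 0.
Proof. by rewrite gt_eqF// ltr_pwDl ?exprn_gt0// divr_ge0// mulr_ge0 ?sqr_ge0. Qed.

Let D0' : U ^+ 2 * 9 + 2 * l ^+ 2 != 0.
Proof. by apply: contra_neq D0 => h; rewrite /D; lra. Qed.

(* On the locus [18 U^2 = 6 - l^2] the entries of the linearization and its
   eigenvalues become homogeneous in [U] and [l]. *)
Definition lin : 'M[R]_3 := mat3
  [:: [:: -3 * U ^+ 2; 0; 0];
      [:: 2 * U / s; -2 * U ^+ 2; 4 * l * U / 3];
      [:: l / (3 * s); l * U / 6; -3 * U ^+ 2 + 2 * l ^+ 2 / 9]].

Definition eigs : 'rV[R]_3 :=
  row3 (-3 * U ^+ 2) (-3 * U ^+ 2) (-2 * U ^+ 2 + 2 * l ^+ 2 / 9).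

(* Since fields act on row vectors, [lin] is the transpose of the usual
   Jacobian matrix; its eigenvectors are the columns of [toeig]. *)
Definition toeig : 'M[R]_3 := mat3
  [:: [:: 1; 0; 0];
      [:: - (2 * U / (s * D)); 4 * l / 3; U];
      [:: - (l / (3 * s * D)); - U; l / 6]].

Definition ofeig : 'M[R]_3 := mat3
  [:: [:: 1; 0; 0];
      [:: 0; l / (6 * D); - U / D];
      [:: 2 / (s * D); U / D; 4 * l / (3 * D)]].

Lemma ofeigK : ofeig *m toeig = 1%:M.
Proof.
by apply/matrixP; apply: ord3P; apply: ord3P; rewrite !mxE sum3 !mxE /=;
  rewrite ?mul0r ?mulr0 ?mul1r ?mulr1 ?addr0 ?add0r // /D; field;
  rewrite ?s0 ?D0'.
Qed.

Lemma toeigK : toeig *m ofeig = 1%:M.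
Proof. exact: mulmx1C ofeigK. Qed.

Lemma lin_diag : ofeig *m lin *m toeig = diag_mx eigs.
Proof.
(* Cancelling [ofeig] on the left leaves the eigenvector equations
   [lin *m toeig = toeig *m diag_mx eigs]. *)
rewrite -[RHS]mul1mx -ofeigK -mulmxA -[RHS]mulmxA; congr (_ *m _).
by apply/matrixP; apply: ord3P; apply: ord3P; rewrite mul_mx_diag !mxE sum3 !mxE /=;
  rewrite ?mul0r ?mulr0 ?mul1r ?mulr1 ?addr0 ?add0r // /D; field;
  rewrite ?s0 ?D0'.
Qed.

(** [w] is the increment from [P2] of the form [2 * S ^+ 2 - U ^+ 2 + P ^+ 2] occurring in all three
    equations; [w2] is its quadratic part. *)
Let w (x : 'rV[R]_3) : R :=
  2 * x 0 0 ^+ 2 - 2 * U * x 0 1 - x 0 1 ^+ 2 + 2 * (l / 3) * x 0 2 + x 0 2 ^+ 2.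
Let w2 (x : 'rV[R]_3) : R := 2 * x 0 0 ^+ 2 - x 0 1 ^+ 2 + x 0 2 ^+ 2.

Definition remainder (x : 'rV[R]_3) : 'rV[R]_3 := row3
  (s^-1 * (x 0 0 ^+ 2 + x 0 1 ^+ 2 + 2^-1 * x 0 2 ^+ 2) + x 0 0 * w x)
  (U * w2 x + x 0 1 * (- (l / 2) * x 0 2 + w x))
  (l * x 0 1 ^+ 2 + l / 3 * w2 x + x 0 2 * w x).

(** In each component the two sides differ by an explicit multiple of [U ^+ 2 - (6 - l ^+ 2) / 18],
    which vanishes. *)
Lemma vfield_expand x : vfield l (P2 l + x) = x *m lin + remainder x.
Proof.
have UK : U ^+ 2 - (6 - l ^+ 2) / 18 = 0 by rewrite U2 subrr.
apply: row3_eq; rewrite [in RHS]mxE [X in _ = X + _]mxE sum3 !mxE /= -/s -/U;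
  apply/eqP; rewrite -subr_eq0 /w /w2; apply/eqP.
- transitivity ((s^-1 + 2 * x 0 0) * (U ^+ 2 - (6 - l ^+ 2) / 18)).
    by field; rewrite s0.
  by rewrite UK mulr0.
- transitivity (- (U + x 0 1) * (U ^+ 2 - (6 - l ^+ 2) / 18)); first by field.
  by rewrite UK mulr0.
- transitivity ((2 * l / 3 + 2 * x 0 2) * (U ^+ 2 - (6 - l ^+ 2) / 18)).
    by field.
  by rewrite UK mulr0.
Qed.

Lemma second_order_remainder (r : R) : 0 < r ->
  exists2 C, 0 <= C & second_order r remainder C.
Proof.
move=> _; have o1 i : order1 r (fun x : 'rV[R]_3 => x 0 i) by exact: order1_coord.
have sq i : order2 r (fun x : 'rV[R]_3 => x 0 i ^+ 2).
  exact: order2M (o1 i) (o1 i).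
have neg f : order2 r f -> order2 r (fun x : 'rV[R]_3 => - f x).
  move=> /(order2Z (-1)); congr order2; apply/funext => x; exact: mulN1r.
have o2w2 : order2 r w2.
  by apply: order2D (sq 2); apply: order2D (neg _ (sq 1)); exact: order2Z.
(* Because of its linear part [w] is only of first order, but in [remainder] it is always multiplied
   by a coordinate. *)
have o1w : order1 r w.
  have -> : w = (fun x => w2 x + ((- (2 * U)) * x 0 1 + 2 * (l / 3) * x 0 2)).
    by apply/funext => x; rewrite /w /w2; ring.
  apply: order1D; first exact: order2_order1.
  by apply: order1D; exact: order1Z.
apply: second_order_row3.
- apply: order2D; last exact: order2M.
  apply: order2Z; apply: order2D; last exact: order2Z.
  exact: order2D.
- apply: order2D; first exact: order2Z.
  apply: order2M => //; apply: order1D => //; exact: order1Z.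
- apply: order2D; last exact: order2M.
  by apply: order2D; exact: order2Z.
Qed.

Let G := diag_field eigs (diag_remainder remainder toeig ofeig).

Let conj : affine_conj (vfield l) (P2 l) G 0 toeig.
Proof. exact: (@diag_field_conj R 2 (vfield l) remainder (P2 l) lin vfield_expand toeig ofeig eigs toeigK lin_diag). Qed.

Let eig2_lt0 : (l < Num.sqrt 2) -> 0 < - eigs 0 2.
Proof.
move=> l2; have : l ^+ 2 < 2.
  by rewrite -[2 in ltRHS]sqr_sqrtr// ltr_pXn2r// ?nnegrE ?sqrtr_ge0.
by rewrite !mxE /= U2; lra.
Qed.

Lemma P2_stable : l < Num.sqrt 2 -> asymptotically_stable (vfield l) (P2 l).
Proof.
move=> l2; apply: asymptotically_stable_affine ofeigK toeigK conj _.
have [C C0 NC] := second_order_diag_remainder toeig ofeig second_order_remainder.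
apply: (@diag_field_sink _ _ _ _ C (Num.min (3 * U ^+ 2) (- eigs 0 2))) => //.
- exact: ltW.
- by rewrite lt_min eig2_lt0// andbT mulr_gt0// exprn_gt0.
- apply: ord3P; rewrite lerNr ge_min.
  + by rewrite !mxE /= mulNr opprK lexx.
  + by rewrite !mxE /= mulNr opprK lexx.
  + by rewrite lexx orbT.
Qed.

Let stable_dirs j : j != 2 -> eigs 0 j <= - (3 * U ^+ 2).
Proof. by elim/ord3P: j => // _; rewrite !mxE /= mulNr. Qed.

(* For [l ^+ 2 = 2] the eigenvalue of the last eigendirection vanishes and the
   field restricted to it reads [6 h^2 + (27/2) h^3]. *)
Let degenerate_growth h : l ^+ 2 = 2 -> 0 < h -> h < 1 ->
  6 * h ^+ 2 <= G (h *: delta_mx 0 2) 0 2.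
Proof.
move=> l2 h0 h1; have lne0 : l != 0.
  by apply: contra_eq_neq l2 => ->; rewrite expr0n eq_sym pnatr_eq0.
have UE : U = l / 3.
  apply/eqP; rewrite -(@eqrXn2 _ 2) ?divr_ge0 ?(ltW U0)// U2 expr_div_n l2.
  by apply/eqP; field.
pose x : 'rV[R]_3 := (h *: delta_mx 0 2) *m ofeig.
have xE i : x 0 i = h * ofeig 2 i.
  by rewrite /x -scalemxAl mxE -rowE mxE.
(* Only the square is needed: the first entry in the last column of [toeig] is [0], and [w] and [w2]
   are even in the first coordinate. *)
have x0 : x 0 0 ^+ 2 = 3 * h ^+ 2.
  rewrite xE !mxE /=; transitivity (h ^+ 2 * 4 / (s ^+ 2 * D ^+ 2)).
    by field; rewrite s0 D0.
  by rewrite s2 /D U2 l2; field.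
have x1 : x 0 1 = l / 2 * h.
  by rewrite xE !mxE /= /D U2 UE l2; field.
have x2 : x 0 2 = 2 * l * h.
  by rewrite xE !mxE /= /D U2 l2; field.
rewrite /G diag_fieldE /diag_remainder -/x [(remainder x *m toeig) 0 2]mxE sum3.
rewrite [remainder x 0 0]mxE [remainder x 0 1]mxE [remainder x 0 2]mxE /=.
rewrite /w /w2 x0 x1 x2 !mxE /= U2 UE !exprMn l2.
rewrite mulr0 add0r.
(* These products make the goal linear in the remaining monomials, as [lra] requires. *)
have e1 : l ^+ 2 * h ^+ 2 = 2 * h ^+ 2 by rewrite l2.
have e2 : l ^+ 2 * h ^+ 3 = 2 * h ^+ 3 by rewrite l2.
have e3 : l ^+ 2 * l ^+ 2 * h ^+ 2 = 4 * h ^+ 2 by rewrite l2; ring.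
have e4 : l ^+ 2 * l ^+ 2 * h ^+ 3 = 4 * h ^+ 3 by rewrite l2; ring.
have : 0 <= h ^+ 3 by rewrite exprn_ge0// ltW.
lra.
Qed.

Lemma P2_unstable : Num.sqrt 2 <= l -> unstable (vfield l) (P2 l).
Proof.
move=> l2; apply: unstable_affine ofeigK toeigK conj _.
have l2' : 2 <= l ^+ 2.
  by rewrite -[2 in leLHS]sqr_sqrtr// lerXn2r ?nnegrE ?sqrtr_ge0.
have [C C0 NC] := second_order_diag_remainder toeig ofeig second_order_remainder.
have a0 : 0 < 3 * U ^+ 2 by rewrite mulr_gt0// exprn_gt0.
have mu : eigs 0 2 = (l ^+ 2 - 2) / 3 by rewrite !mxE /= U2; field.
move: l2'; rewrite le_eqVlt => /predU1P[/esym l2'|l2'].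
  apply: (@diag_field_unstable _ _ _ _ 2 C (3 * U ^+ 2) 6 1) => // h.
  exact: degenerate_growth.
apply: (@diag_field_unstable_pos _ _ _ _ 2 C (3 * U ^+ 2)) => //.
by rewrite mu divr_gt0// subr_gt0.
Qed.

Lemma vfield_P2 : vfield l (P2 l) = 0.
Proof.
have [C _ [N0 _]] := second_order_remainder ltr01.
by rewrite -[P2 l]addr0 vfield_expand mul0mx add0r.
Qed.

Lemma eigenvalues_P2 : eigenvalues_of (jacobian (vfield l) (P2 l))
  [:: -1 + l ^+ 2 / 6; -1 + l ^+ 2 / 6; - (2 / 3) + l ^+ 2 / 3].
Proof.
have [C C0 NC] := second_order_remainder ltr01.
rewrite /eigenvalues_of (jacobian_linearization vfield_expand ltr01 C0 NC).
rewrite (char_poly_diagonalized ofeigK lin_diag).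
rewrite !big_cons big_nil mulr1 !big_ord_recl big_ord0 mulr1 !mxE /= U2.
by congr (('X - _%:P) * (('X - _%:P) * ('X - _%:P))); field.
Qed.

End CriticalPoint.

Theorem mainTheorem5 (R : realType) (lambda : R)
    (hlambda0 : 0 <= lambda) (hlambda6 : lambda < Num.sqrt 6) :
  [/\ vfield lambda (P2 lambda) = 0,
      eigenvalues_of (jacobian (vfield lambda) (P2 lambda))
        [:: -1 + lambda ^+ 2 / 6; -1 + lambda ^+ 2 / 6;
            - (2 / 3) + lambda ^+ 2 / 3],
      lambda < Num.sqrt 2 ->
        asymptotically_stable (vfield lambda) (P2 lambda)
    & Num.sqrt 2 <= lambda -> unstable (vfield lambda) (P2 lambda)].
Proof.
split.
- exact: vfield_P2.
- exact: eigenvalues_P2.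
- exact: P2_stable.
- exact: P2_unstable.
Qed.
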